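(* Let $Q=[0,1]^2$ and let $u:Q\to\mathbb R$ be continuous. Then $u\in\mathrm{BV}(Q)$ if and only if $\mathcal A(u,Q)<\infty$.
   Context: A polyhedral surface $P$ is inscribed in the graph of $u$ if there is a finite triangulation $\mathcal D$ of $Q$ such that $P$ is the graph of the continuous function $v=v(\mathcal D)$ that is affine on each triangle of $\mathcal D$ and agrees with $u$ on the $0$-skeleton (vertices) of $\mathcal D$; one writes $P=P(u,\mathcal D)$. The mesh of $\mathcal D$ is the supremum of the diameters of its triangles. The relaxed area is $$\mathcal A(u,Q):=\inf\Bigl\{\liminf_{h\to\infty}A(P_h)\Bigr\},$$ where $A(P_h)$ is the area of $P_h$ and the infimum is taken among all sequences $\{P_h\}$ of inscribed polyhedral surfaces $P_h=P(u,\mathcal D_h)$ with $\mathrm{mesh}\,\mathcal D_h\to0$ as $h\to\infty$. *)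

(* Defs.v *)
From HB Require Import structures.
From mathcomp Require Import all_boot all_order all_algebra.
From mathcomp Require Import all_classical all_reals all_analysis.

Set Implicit Arguments.
Unset Strict Implicit.
Unset Printing Implicit Defensive.

Import Order.TTheory GRing.Theory Num.Theory.
Import numFieldNormedType.Exports.

Local Open Scope classical_set_scope.
Local Open Scope ring_scope.

Section Defs.
Context {R : realType}.

Definition unit_square : set (R * R) := `[0, 1] `*` `[0, 1].

(* The library norm on [R * R] is the sup norm. *)
Definition enorm (p : R * R) : R := Num.sqrt (p.1 ^+ 2 + p.2 ^+ 2).

Definition diam (A : set (R * R)) : R :=
  sup [set enorm (p.1 - p.2) | p in A `*` A].

Definition convex_hull (s : seq (R * R)) : set (R * R) :=
  [set x | exists w : 'I_(size s) -> R,
    [/\ forall i, 0 <= w i, \sum_i w i = 1 & x = \sum_i w i *: s`_i]].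

(* A triangle is the list of its three vertices; the order is immaterial. *)
Definition triangle := 3.-tuple (R * R).

Definition nondegenerate (T : triangle) : bool :=
  let a := T`_1 - T`_0 in let b := T`_2 - T`_0 in
  a.1 * b.2 - a.2 * b.1 != 0.

(* The faces of a triangle are the hulls of the subsets of its vertices, the
   empty one included.  As distinct members of the list have distinct vertex
   sets, two of them meet in the empty set, a common vertex or a common edge. *)
Definition is_triangulation (Q : set (R * R)) (D : seq triangle) : Prop :=
  [/\ {in D, forall T, nondegenerate T},
      Q = \bigcup_(T in [set` D]) convex_hull T,
      pairwise (fun S T : triangle => ~~ perm_eq S T) D
    & {in D &, forall S T : triangle,
        convex_hull S `&` convex_hull T =
        convex_hull [seq p <- S | p \in (T : seq (R * R))]}].

Definition mesh (D : seq triangle) : R :=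
  sup [set diam (convex_hull T) | T in [set` D]].

Definition affine_on (A : set (R * R)) (v : R * R -> R) : Prop :=
  exists a b c : R, forall x, A x -> v x = a * x.1 + b * x.2 + c.

(* [v] is unique on [Q] when [D] triangulates [Q]; its values outside [Q] are
   irrelevant. *)
Definition interpolates (Q : set (R * R)) (u : R * R -> R)
    (D : seq triangle) (v : R * R -> R) : Prop :=
  [/\ {within Q, continuous v},
      {in D, forall T : triangle, affine_on (convex_hull T) v}
    & {in D, forall T : triangle, {in (T : seq (R * R)), v =1 u}}].

(* half the Euclidean norm of the cross product (q - p) x (r - p) *)
Definition triangle_area3 (p q r : R * R * R) : R :=
  let a := q - p in let b := r - p in
  Num.sqrt ((a.1.2 * b.2 - a.2 * b.1.2) ^+ 2
          + (a.2 * b.1.1 - a.1.1 * b.2) ^+ 2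
          + (a.1.1 * b.1.2 - a.1.2 * b.1.1) ^+ 2) / 2.

(* The polyhedral surface is the graph of [v] over the union of [D]; its faces
   are the triangles of the graph lying above the members of [D]. *)
Definition polyhedral_area (D : seq triangle) (v : R * R -> R) : R :=
  let g x := (x, v x) in
  \sum_(T <- D) triangle_area3 (g T`_0) (g T`_1) (g T`_2).

Definition relaxed_area (u : R * R -> R) (Q : set (R * R)) : \bar R :=
  ereal_inf [set limn_einf (fun h => (polyhedral_area (P h).1 (P h).2)%:E)
    | P in [set P : nat -> seq triangle * (R * R -> R) |
        [/\ forall h, is_triangulation Q (P h).1,
            forall h, interpolates Q u (P h).1 (P h).2
          & mesh (P h).1 @[h --> \oo] --> (0 : R)]]].

Definition lebesgue2 : {measure set (measurableTypeR R * measurableTypeR R)%type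
    -> \bar R} :=
  (@lebesgue_measure R \x @lebesgue_measure R)%E.

Definition dx (f : R * R -> R) (x : R * R) : R := 'D_(1, 0) f x.
Definition dy (f : R * R -> R) (x : R * R) : R := 'D_(0, 1) f x.

Definition is_C1 (f : R * R -> R) : Prop :=
  [/\ forall x, derivable f x (1, 0), forall x, derivable f x (0, 1),
      continuous (dx f) & continuous (dy f)].

Definition compactly_supported (Omega : set (R * R)) (f : R * R -> R) : Prop :=
  let K := closure [set x | f x != 0] in compact K /\ K `<=` Omega.

Definition test_field (Omega : set (R * R)) : set ((R * R -> R) * (R * R -> R)) :=
  [set phi | [/\ is_C1 phi.1 /\ is_C1 phi.2,
                 compactly_supported Omega phi.1,
                 compactly_supported Omega phi.2
               & forall x, enorm (phi.1 x, phi.2 x) <= 1]].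

Definition variation2 (Omega : set (R * R)) (u : R * R -> R) : \bar R :=
  ereal_sup
    [set (\int[lebesgue2]_(x in Omega) (u x * (dx phi.1 x + dy phi.2 x))%:E)%E
    | phi in test_field Omega].

(* BV on an open set: L^1 functions of finite total variation *)
Definition BV (Omega : set (R * R)) (u : R * R -> R) : Prop :=
  lebesgue2.-integrable Omega (EFin \o u) /\ (variation2 Omega u < +oo)%E.

End Defs.

(* Main.v *)
(** If inscribed surfaces [v_h -> u] have bounded areas, fix a partition
    [x_k = k/N].  On a horizontal line, [sum_k |v_h(x_{k+1}, y) - v_h(x_k, y)|]
    is at most a sum over the triangles meeting the line of (slope) * (width);
    its integral in [y] is at most a multiple of the area, because for a triangle
    (width) * (height) is at most twice its planar area.  Uniform convergence passes
    this bound to [u], and summation by parts bounds [int u dx phi].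

    Conversely, cut each cell of a grid of step [1/n] into [q^2] small cells and
    test [u] against [sum_kl s_kl (B_k - B_{k+q})(x) b_l(y)], where [b_l] are bumps
    supported in the small cells, [B_k' = b_k] and the [s_kl] are signs.  For [q]
    large this bounds the sum of [|u(c_{k+q,l}) - u(c_kl)|] over all centres
    of small cells, so by averaging some translate of the coarse grid has bounded
    variation.  That grid, completed by the boundary of the square and cut along
    diagonals, carries an inscribed surface of bounded area. *)

Require Import Defs.
From mathcomp Require Import all_boot all_order all_algebra.
From mathcomp Require Import all_classical all_reals all_analysis.
From mathcomp Require Import measurable_realfun.
From mathcomp Require Import ring lra zify.

Set Implicit Arguments.
Unset Strict Implicit.
Unset Printing Implicit Defensive.

(* [Defs] is imported again because [nondegenerate] is shadowed by a homonym. *)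
Import Defs Order.TTheory GRing.Theory Num.Theory.
Import numFieldNormedType.Exports.

Local Open Scope classical_set_scope.
Local Open Scope ring_scope.

(** * Integration over the square *)

Section Square.
Context {R : realType}.
Implicit Types (f g U : R * R -> R) (p q : R * R).

Notation mu := (@lebesgue_measure R).
Notation S := (@unit_square R)^°.

(** The total variation sees only integrals of [u], whereas an inscribed surface needs point values.
    The passage costs an error of order 1/n for each pair of centres, which continuity grants once q
    is large; about (nq)^2 pairs then contribute an error of order n q^2, the same order as the main
    term. After division by the q^2 translates, the increments over one coarse grid add up to O(n),
    and each enters the area multiplied by an edge of length at most about 1/n, so the areas stay
    bounded.

    The difference B_k - B_{k+q} is used because B_k alone is constant, not zero, to the right of
    its bump. These differences are nonnegative plateaus about one coarse step long, of which about
    q overlap at a point, so a factor of order n makes the test field of size 1.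

    In the other direction, the crossings of a line with the triangles are never put in order:
    increments of v_h are compared with those of a monotone majorant, and the closedness of the
    triangles glues the local comparisons together. *)

Lemma interior_unit_square : S = `]0, 1[ `*` `]0, 1[.
Proof.
apply/seteqP; split=> -[x y].
- rewrite /interior/= => -[[A B]] /= [nA nB] AB.
  have sA : A `<=` `[0, 1].
    by move=> z Az; have [] := AB (z, y) (conj Az (nbhs_singleton nB)).
  have sB : B `<=` `[0, 1].
    by move=> z Bz; have [] := AB (x, z) (conj (nbhs_singleton nA) Bz).
  have : interior `[(0:R), 1] x by apply: filterS nA.
  have : interior `[(0:R), 1] y by apply: filterS nB.
  by rewrite !interior_itv_bnd.
- move=> [/= x01 y01].
  exists (`]0, 1[%classic, `]0, 1[%classic) => /=.
    by split; apply: open_nbhs_nbhs; split => //; exact: interval_open.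
  by move=> -[a b] [/= ha hb]; split => /=; apply: subset_itv_oo_cc.
Qed.

(** [lebesgue2] lives on the product sigma-algebra. It contains the open sets of the plane because
    each of them is a union of squares with rational centre and radius, and these are countably
    many. *)
Lemma open_prod_measurable (A : set (R * R)) : open A ->
  measurable (A : set (measurableTypeR R * measurableTypeR R)%type).
Proof.
move=> oA.
pose B (q : rat * rat * rat) : set (R * R) :=
  ball (ratr q.1.1 : R) (ratr q.2) `*` ball (ratr q.1.2 : R) (ratr q.2).
have -> : A = \bigcup_(q in [set q | B q `<=` A]) B q.
  apply/seteqP; split; last by move=> p [q /= qA]; apply: qA.
  move=> [x y] Axy; have /nbhs_ballP[e /= e0 xyA] := open_nbhs_nbhs (conj oA Axy).
  have e4 : 0 < e / 4 by lra.
  (* A centre within e/4 of the point and a radius between e/4 and e/2 give a square that contains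
     the point and stays within 3e/4 of it. *)
  have [r] : exists r : rat, ratr r \in `]e/4, e/2[.
    by apply: rat_in_itvoo; lra.
  rewrite in_itv/= => /andP[r1 r2].
  have [a] : exists a : rat, ratr a \in `]x - e/4, x + e/4[.
    by apply: rat_in_itvoo; lra.
  rewrite in_itv/= => /andP[a1 a2].
  have [b] : exists b : rat, ratr b \in `]y - e/4, y + e/4[.
    by apply: rat_in_itvoo; lra.
  rewrite in_itv/= => /andP[b1 b2].
  exists (a, b, r) => /=.
  - move=> [z t] []; rewrite /ball/= !ltr_norml => /andP[h1 h2] /andP[h3 h4].
    by apply: xyA; split; rewrite /ball/= ltr_norml; lra.
  - by split; rewrite /= /ball/= ltr_norml; lra.
rewrite bigcup_mkcond; apply: countable_bigcupT_measurable.
  exact: countableP.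
move=> q; case: ifP => // _; apply: measurableX; 
  apply: (@open_measurable R); exact: ball_open.
Qed.

Lemma continuous_prod_measurable f : continuous f ->
  measurable_fun setT (f : (measurableTypeR R * measurableTypeR R)%type -> R).
Proof.
move=> /continuousP cf; apply: (measurability _ (RGenOpens.measurableE R)).
move=> _ [_ [a [b ->] <-]]; rewrite setTI.
by apply: open_prod_measurable; apply: cf; exact: interval_open.
Qed.

Lemma dist_triangle (y x z : R) : `|x - z| <= `|x - y| + `|y - z|.
Proof. exact: ler_distD. Qed.

Lemma compact_unit_square : compact (@unit_square R).
Proof. by apply: compact_setX; exact: segment_compact. Qed.

Lemma continuous_bounded f : continuous f ->
  exists2 M, 0 <= M & forall p, unit_square p -> `|f p| <= M.
Proof.
move=> cf.
have : compact (f @` (@unit_square R)).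
  apply: continuous_compact; last exact: compact_unit_square.
  exact: continuous_subspaceT.
move=> /compact_bounded [M [_ hM]].
exists (`|M| + 1); first by rewrite addr_ge0.
move=> p Qp; apply: (hM (`|M| + 1)); last by exists p.
by rewrite (le_lt_trans (ler_norm _))// ltrDl.
Qed.

(** Heine-Cantor with only one of the two points confined to the square. The [near_covering] form of
    compactness lets the radius vary together with the point, so no finite subcover has to be
    extracted. *)
Lemma continuous_unif f : continuous f -> forall e : R, 0 < e ->
  exists2 d : R, 0 < d & forall p q, unit_square p ->
    `|p.1 - q.1| < d -> `|p.2 - q.2| < d -> `|f p - f q| < e.
Proof.
move=> cf e e0.
pose P (d : R) p := forall q, `|p.1 - q.1| < d -> `|p.2 - q.2| < d -> `|f p - f q| < e.
have loc : forall p, unit_square p -> \forall p' \near p & d \near 0^'+, P d p'.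
  move=> p Qp.
  have e2 : 0 < e / 2 by lra.
  have /nbhs_ballP[d /= d0 hd] : nbhs p [set t | `|f p - f t| < e / 2].
    by have /cvgrPdist_lt := cf p; exact.
  exists (ball p (d/2), [set x : R | x < d/2]) => /=.
    split; first by apply: nbhsx_ballx; lra.
    by apply: nbhs_right_lt; lra.
  move=> [p' d'] /= [[h1 h2] d'd] q q1 q2.
  have k0 : d' < d / 2 := d'd.
  have k1 : `|p.1 - p'.1| < d / 2 := h1.
  have k2 : `|p.2 - p'.2| < d / 2 := h2.
  have k3 : `|p.1 - q.1| < d by have := dist_triangle p'.1 p.1 q.1; lra.
  have k4 : `|p.2 - q.2| < d by have := dist_triangle p'.2 p.2 q.2; lra.
  have hp' : `|f p - f p'| < e / 2.
    by apply: hd; split; [move: h1|move: h2]; apply: le_ball; lra.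
  have hq : `|f p - f q| < e / 2 by apply: hd; split.
  by have := dist_triangle (f p) (f p') (f q); rewrite [`|f p' - f p|]distrC; lra.
have : near_covering (@unit_square R) by apply/compact_near_coveringP/compact_unit_square.
move=> /(_ R (0^'+) P _ loc) [d /= d0 hd].
exists (d/2); first lra.
move=> p q Qp; apply: (hd (d/2)) => //=; last by lra.
by rewrite sub0r normrN gtr0_norm; lra.
Qed.

Definition clamp01 (x : R) : R := Num.max 0 (Num.min x 1).

(** Composition with the retraction of the plane onto the square: a function continuous only on the
    square becomes continuous everywhere, and its values on the square are kept. *)
Definition ext (u : R * R -> R) p : R := u (clamp01 p.1, clamp01 p.2).

Lemma clamp01_itv x : 0 <= clamp01 x <= 1.
Proof.
by rewrite /clamp01 /Order.max /Order.min; case: (ltP x 1) => ?;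
  [case: (ltP 0 x) => ?|rewrite ltr01]; lra.
Qed.

Lemma clamp01_id x : 0 <= x <= 1 -> clamp01 x = x.
Proof.
by rewrite /clamp01 /Order.max /Order.min; case: (ltP x 1) => ?;
  [case: (ltP 0 x) => ?|rewrite ltr01]; lra.
Qed.

Lemma unit_squareP p : unit_square p <-> (0 <= p.1 <= 1) /\ (0 <= p.2 <= 1).
Proof. by rewrite /unit_square; split => -[]; rewrite /= !in_itv. Qed.

Lemma ext_id (u : R * R -> R) p : unit_square p -> ext u p = u p.
Proof. by case: p => x y /unit_squareP[? ?]; rewrite /ext !clamp01_id. Qed.

Lemma continuous_maxr (T : topologicalType) (f g : T -> R) :
  continuous f -> continuous g -> continuous (fun x => Num.max (f x) (g x)).
Proof. by move=> cf cg x; apply: (@continuous_max R T f g x); [exact: cf|exact: cg]. Qed.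

Lemma continuous_minr (T : topologicalType) (f g : T -> R) :
  continuous f -> continuous g -> continuous (fun x => Num.min (f x) (g x)).
Proof. by move=> cf cg x; apply: (@continuous_min R T f g x); [exact: cf|exact: cg]. Qed.

Lemma continuous_clamp01 : continuous clamp01.
Proof.
apply: continuous_maxr; first by move=> x; exact: cvg_cst.
by apply: continuous_minr; [move=> x; exact: cvg_id|move=> x; exact: cvg_cst].
Qed.

Lemma ext_continuous (u : R * R -> R) : {within unit_square, continuous u} -> continuous (ext u).
Proof.
move=> cu p; pose c (p : R * R) := (clamp01 p.1, clamp01 p.2).
have Qc : forall p, unit_square (c p).
  by move=> q; apply/unit_squareP; rewrite !clamp01_itv.
have cc : {for p, continuous c}.
  apply: (@cvg_pair _ _ _ _ (nbhs (clamp01 p.1)) (nbhs (clamp01 p.2))) => /=.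
    by apply: continuous_comp; [exact: cvg_fst|exact: continuous_clamp01].
  by apply: continuous_comp; [exact: cvg_snd|exact: continuous_clamp01].
move/subspace_continuousP : cu => /(_ (c p) (Qc p)) ucp.
apply: (cvg_trans _ ucp) => A /= hA; have {}hA : nbhs (c p) [set y | unit_square y -> A (u y)] by exact: hA.
have := cc _ hA; rewrite /= /nbhs/=; apply: filterS => q /=; exact.
Qed.

End Square.

Section SquareInt.
Context {R : realType}.
Implicit Types (f g U : R * R -> R) (p q : R * R).

Notation mu := (@lebesgue_measure R).
Notation S := (@unit_square R)^°.

Definition sq_int f : R := \int[lebesgue2]_(p in S) f p.

Lemma measurable_square : measurable (S : set (measurableTypeR R * measurableTypeR R)%type).
Proof. by rewrite interior_unit_square; apply: measurableX; exact: measurable_itv. Qed.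

Lemma lebesgue2_square : lebesgue2 S = 1%:E.
Proof.
rewrite interior_unit_square.
transitivity (mu `]0%R, 1%R[ * mu `]0%R, 1%R[)%E.
  by apply: (product_measure1E mu mu); exact: measurable_itv.
rewrite /= !lebesgue_measure_itv/= lte_fin ltr01 oppr0.
by rewrite -EFinD addr0 mule1.
Qed.

Lemma sub_square p : S p -> unit_square p.
Proof. exact: interior_subset. Qed.

Lemma integrable_square f : continuous f ->
  lebesgue2.-integrable S (EFin \o f).
Proof.
move=> cf; have [M M0 hM] := continuous_bounded cf.
apply: measurable_bounded_integrable.
- exact: measurable_square.
- by rewrite lebesgue2_square ltry.
- apply: measurable_funS (continuous_prod_measurable cf) => //.
- exists M; split; first exact: num_real.
  by move=> N MN p Sp; apply: (le_trans (hM _ (sub_square Sp))); exact: ltW.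
Qed.

Definition swap p : R * R := (p.2, p.1).

Lemma continuous_swap : continuous swap.
Proof. by move=> p; apply: (@cvg_pair _ _ _ _ (nbhs p.2) (nbhs p.1)); [exact: cvg_snd|exact: cvg_fst]. Qed.

Lemma integral_square f : continuous f ->
  (\int[lebesgue2]_(p in S) (f p)%:E = \int[mu]_(y in `]0%R, 1%R[) \int[mu]_(x in `]0%R, 1%R[) (f (x, y))%:E)%E.
Proof.
move=> cf; rewrite integral_mkcond -integral21_prod_meas1 /=; last first.
  have := integrable_square cf; rewrite (integrable_mkcond _ measurable_square); exact.
rewrite [in RHS]integral_mkcond; apply: eq_integral => y _.
rewrite /fubini_G patchE; case: ifPn => hy.
  rewrite [RHS]integral_mkcond; apply: eq_integral => x _.
  rewrite !patchE; congr (if _ then _ else _).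
  apply/idP/idP; rewrite !inE interior_unit_square; first by case.
  by move=> ?; split => //; rewrite inE in hy.
apply: integral0_eq => x _; rewrite patchE ifF//.
by apply/negbTE; apply: contra hy; rewrite !inE interior_unit_square => -[].
Qed.

Lemma integral_square_swap f : continuous f ->
  (\int[lebesgue2]_(p in S) (f p)%:E = \int[mu]_(x in `]0%R, 1%R[) \int[mu]_(y in `]0%R, 1%R[) (f (x, y))%:E)%E.
Proof.
move=> cf; rewrite integral_mkcond -integral12_prod_meas1 /=; last first.
  have := integrable_square cf; rewrite (integrable_mkcond _ measurable_square); exact.
rewrite [in RHS]integral_mkcond; apply: eq_integral => x _.
rewrite /fubini_F patchE; case: ifPn => hx.
  rewrite [RHS]integral_mkcond; apply: eq_integral => y _.
  rewrite !patchE; congr (if _ then _ else _).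
  apply/idP/idP; rewrite !inE interior_unit_square; first by case.
  by move=> ?; split => //; rewrite inE in hx.
apply: integral0_eq => y _; rewrite patchE ifF//.
by apply/negbTE; apply: contra hx; rewrite !inE interior_unit_square => -[].
Qed.

Lemma sq_int_swap f : continuous f -> sq_int (f \o swap) = sq_int f.
Proof.
move=> cf; rewrite /sq_int /Rintegral integral_square; last first.
  by move=> p; apply: continuous_comp; [exact: continuous_swap|exact: cf].
by rewrite integral_square_swap.
Qed.

Lemma sq_intE f : continuous f ->
  (\int[lebesgue2]_(p in S) (f p)%:E = (sq_int f)%:E)%E.
Proof.
move=> cf; rewrite /sq_int /Rintegral fineK//.
apply: integrable_fin_num; [exact: measurable_square|exact: integrable_square].
Qed.

Lemma continuous_line f y : continuous f -> continuous (fun x => f (x, y)).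
Proof.
move=> cf x; apply: (@continuous_comp _ _ _ (fun x => (x, y)) f); last exact: cf.
by apply: (@cvg_pair _ _ _ _ (nbhs x) (nbhs y)); [exact: cvg_id|exact: cvg_cst].
Qed.

Lemma integrable_itv (h : R -> R) a b : continuous h ->
  mu.-integrable `[a, b] (EFin \o h).
Proof.
move=> ch; apply: continuous_compact_integrable; first exact: segment_compact.
exact: continuous_subspaceT.
Qed.

Lemma integral_oo (h : R -> R) a b : continuous h ->
  (\int[mu]_(x in `]a, b[) (h x)%:E = (\int[mu]_(x in `[a, b]) h x)%:E)%E.
Proof.
move=> ch; rewrite integral_itv_bndo_bndc; last first.
  by apply/measurable_EFinP; apply: measurable_funS (continuous_measurable_fun ch).
rewrite integral_itv_obnd_cbnd; last first.
  by apply/measurable_EFinP; apply: measurable_funS (continuous_measurable_fun ch).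
by rewrite /Rintegral fineK//; apply: integrable_fin_num => //; exact: integrable_itv.
Qed.

Lemma continuous_mulr (T : topologicalType) (g h : T -> R) :
  continuous g -> continuous h -> continuous (fun x => g x * h x).
Proof. by move=> cg ch x; apply: cvgM; [exact: cg|exact: ch]. Qed.

Lemma continuous_addr (T : topologicalType) (g h : T -> R) :
  continuous g -> continuous h -> continuous (fun x => g x + h x).
Proof. by move=> cg ch x; apply: cvgD; [exact: cg|exact: ch]. Qed.

Lemma continuous_subr (T : topologicalType) (g h : T -> R) :
  continuous g -> continuous h -> continuous (fun x => g x - h x).
Proof. by move=> cg ch x; apply: cvgB; [exact: cg|exact: ch]. Qed.

Lemma continuous_absr (T : topologicalType) (g : T -> R) :
  continuous g -> continuous (fun x => `|g x|).
Proof. by move=> cg x; apply: cvg_norm; exact: cg. Qed.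

Lemma continuous_sumr (T : topologicalType) (I : Type) (s : seq I) (g : I -> T -> R) :
  (forall i, continuous (g i)) -> continuous (fun x => \sum_(i <- s) g i x).
Proof.
move=> cg; elim: s => [|i s IH].
  by under eq_fun do rewrite big_nil; move=> x; exact: cvg_cst.
by under eq_fun do rewrite big_cons; exact: continuous_addr.
Qed.

Lemma continuous_comp1 (T : topologicalType) (g : T -> R) (h : R -> R) :
  continuous g -> continuous h -> continuous (fun x => h (g x)).
Proof. by move=> cg ch x; apply: continuous_comp; [exact: cg|exact: ch]. Qed.

Lemma continuous_fst1 : continuous (fun p : R * R => p.1).
Proof. by move=> p; exact: cvg_fst. Qed.

Lemma continuous_snd1 : continuous (fun p : R * R => p.2).
Proof. by move=> p; exact: cvg_snd. Qed.

Lemma sq_int_prod (g h : R -> R) : continuous g -> continuous h ->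
  sq_int (fun p => g p.1 * h p.2) =
  (\int[mu]_(x in `[0, 1]) g x) * (\int[mu]_(y in `[0, 1]) h y).
Proof.
move=> cg ch; apply: EFin_inj.
have cgh : continuous (fun p : R * R => g p.1 * h p.2).
  apply: continuous_mulr; [exact: (continuous_comp1 continuous_fst1)|].
  exact: (continuous_comp1 continuous_snd1).
rewrite -sq_intE// integral_square//=.
transitivity (\int[mu]_(y in `]0%R, 1%R[) ((\int[mu]_(x in `[0%R, 1%R]) g x)%R * h y)%:E)%E.
  apply: eq_integral => y _; rewrite -RintegralZr//; last exact: integrable_itv.
  rewrite -integral_oo//.
  by apply: continuous_mulr => // x; exact: cvg_cst.
rewrite integral_oo; last by apply: continuous_mulr => // x; exact: cvg_cst.
by rewrite RintegralZl//; exact: integrable_itv.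
Qed.

(** The majorant [g] is only assumed integrable, since it will be a step function of the height;
    Fubini is applied to [f] alone and the comparison is made slice by slice. *)
Lemma sq_int_le_iterated f (g : R -> R) : continuous f ->
  mu.-integrable `]0, 1[ (EFin \o g) ->
  (forall y, 0 < y < 1 -> \int[mu]_(x in `[0, 1]) f (x, y) <= g y) ->
  sq_int f <= \int[mu]_(y in `]0, 1[) g y.
Proof.
move=> cf ig fg.
have fing : (\int[mu]_(y in `]0%R, 1%R[) (g y)%:E)%E \is a fin_num.
  exact: integrable_fin_num.
(* [fubini_F] integrates the second variable first; after the swap the inner integral is the one
   along horizontal lines. *)
pose h := f \o swap.
have ch : continuous h.
  by move=> p; apply: continuous_comp; [exact: continuous_swap|exact: cf].
rewrite -sq_int_swap// -lee_fin -sq_intE// /Rintegral fineK//.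
have ih := integrable_square ch.
rewrite (integrable_mkcond _ measurable_square) in ih.
rewrite [leLHS]integral_mkcond [leRHS]integral_mkcond -integral12_prod_meas1//=.
apply: le_integral => //.
- exact: (integrable_fubini_F ih).
- by rewrite -integrable_mkcond.
move=> x _; rewrite /fubini_F [leRHS]patchE; case: ifPn => hx; last first.
  rewrite integral0_eq// => y _; rewrite patchE ifF//.
  by apply/negbTE; apply: contra hx; rewrite !inE interior_unit_square => -[].
have x01 : 0 < x < 1 by rewrite inE /= in_itv in hx.
apply: (@le_trans _ _ (\int[mu]_(y in `[0%R, 1%R]) f (y, x))%:E); last first.
  by rewrite /= lee_fin; exact: fg.
rewrite -integral_oo; last exact: continuous_line.
rewrite [leRHS]integral_mkcond le_eqVlt; apply/orP; left; apply/eqP.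
apply: eq_integral => y _; rewrite !patchE; congr (if _ then _ else _).
apply/idP/idP; rewrite !inE interior_unit_square; first by case.
by move=> ?; split => //; rewrite inE in hx.
Qed.

Lemma sq_intD f g : continuous f -> continuous g ->
  sq_int (fun p => f p + g p) = sq_int f + sq_int g.
Proof.
move=> cf cg; rewrite /sq_int RintegralD//; first exact: measurable_square.
  exact: integrable_square.
exact: integrable_square.
Qed.

Lemma sq_intZ a f : continuous f -> sq_int (fun p => a * f p) = a * sq_int f.
Proof.
move=> cf; rewrite /sq_int RintegralZl//; first exact: measurable_square.
exact: integrable_square.
Qed.

Lemma sq_intB f g : continuous f -> continuous g ->
  sq_int (fun p => f p - g p) = sq_int f - sq_int g.
Proof.
move=> cf cg; rewrite /sq_int RintegralB//; first exact: measurable_square.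
  exact: integrable_square.
exact: integrable_square.
Qed.

Lemma sq_int_sum (I : Type) (s : seq I) (F : I -> R * R -> R) :
  (forall i, continuous (F i)) ->
  sq_int (fun p => \sum_(i <- s) F i p) = \sum_(i <- s) sq_int (F i).
Proof.
move=> cF; elim: s => [|i s IH].
  rewrite big_nil /sq_int; under eq_Rintegral do rewrite big_nil.
  by rewrite Rintegral_cst ?mul0r//; exact: measurable_square.
rewrite big_cons -IH -sq_intD//; last exact: continuous_sumr.
by congr sq_int; apply/funext => p; rewrite big_cons.
Qed.

Lemma le_sq_int f g : continuous f -> continuous g ->
  (forall p, unit_square p -> f p <= g p) -> sq_int f <= sq_int g.
Proof.
move=> cf cg fg; apply: le_Rintegral; first exact: measurable_square.
- exact: integrable_square.
- exact: integrable_square.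
by move=> p /sub_square; exact: fg.
Qed.

End SquareInt.

(** * One-dimensional estimates *)

Section Line.
Context {R : realType}.
Notation mu := (@lebesgue_measure R).

(** Let s be the supremum of the points where [g] is at least [g a]. Just to the right of s, any set
    of the cover that is met also contains s, because finitely many closed sets missing s stay away
    from it; monotonicity on that set carries the inequality past s. Applied to the slices of the
    triangles, this avoids subdividing the line at their edges. *)
Lemma monotone_on_cover (I : eqType) (D : seq I) (A : I -> set R) (g : R -> R) (a b : R) :
  a <= b -> continuous g -> (forall i, i \in D -> closed (A i)) ->
  (forall x, a <= x <= b -> exists2 i, i \in D & A i x) ->
  (forall i x y, i \in D -> a <= x -> x <= y -> y <= b -> A i x -> A i y -> g x <= g y) ->
  g a <= g b.
Proof.
move=> ab cg cA cov mon.
pose S := [set x | a <= x <= b /\ g a <= g x].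
have Sa : S a by split; rewrite ?lexx.
have bS : has_sup S by split; [exists a|exists b => x [/andP[]]].
pose s := sup S.
have as_ : a <= s by apply: sup_upper_bound.
have sb : s <= b by apply: ge_sup; [exists a|move=> x [/andP[]]].
have gs : g a <= g s.
  rewrite leNgt; apply/negP => gsa.
  have : \forall x \near s, g x < g a by have := cg s; move/cvgr_lt; exact.
  move=> /nbhs_ballP[e /= e0 he].
  have [x [xab gx] xs] := sup_adherent e0 bS.
  have xles : x <= s by apply: sup_upper_bound.
  suff : g x < g a by rewrite ltNge gx.
  apply: he; rewrite /ball/=.
  have -> : `|s - x| = s - x by rewrite ger0_norm// subr_ge0.
  by rewrite -/s in xs; lra.
have [sEb|snb] := eqVneq s b; first by rewrite -sEb.
have {}sb : s < b by rewrite lt_neqAle snb.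
(* Finiteness and closedness enter here, by induction on the list of sets. *)
have N : \forall x \near s, forall i, i \in D -> ~ A i s -> ~ A i x.
  elim: D cA {cov mon} => [|i D IH] cA; first by near=> x.
  have /IH {}IH : forall j, j \in D -> closed (A j).
    by move=> j jD; apply: cA; rewrite inE jD orbT.
  have [Ais|nAis] := pselect (A i s).
    by apply: filterS IH => x h j; rewrite inE => /predU1P[-> /(_ Ais)//|]; exact: h.
  have : \forall x \near s, ~ A i x.
    by apply: open_nbhs_nbhs; split => //; apply: closed_openC; apply: cA; rewrite inE eqxx.
  by apply: filterS2 IH => x h1 h2 j; rewrite inE => /predU1P[->//|]; exact: h1.
have [x [xs xb Nx]] : exists x, [/\ s < x, x <= b & forall i, i \in D -> ~ A i s -> ~ A i x].
  move: N => /nbhs_ballP[e /= e0 he].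
  exists (Num.min b (s + e/2)); rewrite lt_min sb ge_min lexx; split => //; first lra.
  apply: he; rewrite /ball/=.
  have : s < Num.min b (s + e/2) by rewrite lt_min sb; lra.
  have : Num.min b (s + e/2) <= s + e/2 by rewrite ge_min lexx orbT.
  by move: (Num.min _ _) => z h1 h2; rewrite ltr_norml; lra.
have [i iD Aix] := cov x (ltac:(lra)).
have Ais : A i s by apply: contrapT => nAis; exact: Nx _ _ nAis Aix.
have gsx := mon i s x iD as_ (ltW xs) xb Ais Aix.
have : S x by split; [lra|exact: le_trans gsx].
by move=> /(sup_upper_bound bS); rewrite -/s; lra.
Unshelve. all: by end_near.
Qed.

Lemma Rintegral_FTC (F f : R -> R) (a b : R) : a <= b -> continuous f ->
  (forall x : R, is_derive x 1 F (f x)) ->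
  \int[mu]_(x in `[a, b]) f x = F b - F a.
Proof.
rewrite le_eqVlt => /predU1P[->|ab] cf dF.
  by rewrite set_itv1 Rintegral_set1 subrr.
have dF' x : derivable F x 1 by [].
have cF : continuous F by move=> x; apply: differentiable_continuous; apply/derivable1_diffP.
rewrite /Rintegral (@continuous_FTC2 _ f F)//.
- exact: continuous_subspaceT.
- split => //.
  + by apply: cvg_at_right_filter; exact: cF.
  + by apply: cvg_at_left_filter; exact: cF.
- by move=> x _; rewrite derive1E; have := dF x; move=> h; rewrite derive_val.
Qed.

Lemma Rintegral_cat (f : R -> R) (a b c : R) : continuous f -> a <= b -> b <= c ->
  \int[mu]_(x in `[a, c]) f x =
  \int[mu]_(x in `[a, b]) f x + \int[mu]_(x in `[b, c]) f x.
Proof.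
move=> cf ab bc; apply/eqP; rewrite addrC -subr_eq; apply/eqP.
rewrite (@Rintegral_itvB _ f (BLeft a) (BRight c) b) ?bnd_simp//; last exact: integrable_itv.
apply: Rintegral_itv_obnd_cbnd.
by apply: integrableS (integrable_itv b c cf) => //; exact: subset_itv_oc_cc.
Qed.

(** On each subinterval [f] is frozen at the left endpoint, so that [dpsi] integrates exactly to an
    increment of [psi]; freezing costs at most [e * K] over the whole interval. Abel summation then
    moves the increments from [psi] to [f]. *)
Lemma line_ibp (f psi dpsi : R -> R) (N : nat) (e K : R) :
  continuous f -> continuous dpsi -> (forall x : R, is_derive x 1 psi (dpsi x)) ->
  (0 < N)%N -> 0 <= K -> 0 <= e ->
  psi 0 = 0 -> psi 1 = 0 -> (forall x, `|psi x| <= 1) ->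
  (forall x, 0 <= x <= 1 -> `|dpsi x| <= K) ->
  (forall x y, 0 <= x <= 1 -> 0 <= y <= 1 -> `|x - y| <= N%:R^-1 -> `|f x - f y| <= e) ->
  \int[mu]_(x in `[0, 1]) (f x * dpsi x) <=
  \sum_(k < N) `|f (k.+1%:R / N%:R) - f (k%:R / N%:R)| + e * K.
Proof.
move=> cf cdpsi dpsiP N0 K0 e0 psi0 psi1 psiM dpsiM osc.
have NR0 : 0 < N%:R :> R by rewrite ltr0n.
pose x (k : nat) : R := k%:R / N%:R.
have cfd := continuous_mulr cf cdpsi.
(* The invariant carries the boundary term of the Abel summation; it vanishes at both ends because
   [psi] does. *)
have key k : (k <= N)%N -> \int[mu]_(t in `[0, x k]) (f t * dpsi t) <=
    f (x k) * psi (x k) + \sum_(j < k) `|f (x j.+1) - f (x j)| + e * K * (k%:R / N%:R).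
  elim: k => [|k IH] kN.
    by rewrite /x !mul0r set_itv1 Rintegral_set1 psi0 big_ord0 !mulr0 !addr0.
  have {}IH := IH (ltnW kN).
  have xk0 : 0 <= x k by rewrite divr_ge0// ltW.
  have xkS : x k.+1 = x k + N%:R^-1 by rewrite /x -natr1 mulrDl div1r.
  have Ninv : 0 < N%:R^-1 :> R by rewrite invr_gt0.
  have xkk : x k <= x k.+1 by rewrite xkS; lra.
  have xk1 : x k.+1 <= 1 by rewrite /x ler_pdivrMr// mul1r ler_nat.
  have step : \int[mu]_(t in `[x k, x k.+1]) (f t * dpsi t) <= f (x k) * (psi (x k.+1) - psi (x k)) + e * K * N%:R^-1.
    have cc (r : R) : continuous (fun t : R => r * dpsi t).
      by apply: continuous_mulr => //; move=> z; exact: cvg_cst.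
    rewrite -(Rintegral_FTC xkk cdpsi dpsiP) -RintegralZl//; last exact: integrable_itv.
    have -> : e * K * N%:R^-1 = \int[mu]_(t in `[x k, x k.+1]) (e * K).
      rewrite Rintegral_cst//= lebesgue_measure_itv/= lte_fin xkS ltrDl Ninv -EFinD /=.
      by congr (_ * _); ring.
    rewrite -RintegralD//=; first last.
    - by apply: integrable_itv => z; exact: cvg_cst.
    - exact: integrable_itv.
    apply: le_Rintegral => //.
    - exact: integrable_itv.
    - apply: integrable_itv; apply: continuous_addr => //.
      by move=> z; exact: cvg_cst.
    move=> t /=; rewrite in_itv/= => /andP[t1 t2].
    have t01 : 0 <= t <= 1 by lra.
    have : (f t - f (x k)) * dpsi t <= e * K.
      apply: le_trans (ler_norm _) _; rewrite normrM; apply: ler_pM => //.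
        apply: osc => //; first lra.
        by rewrite ger0_norm; lra.
      exact: dpsiM.
    by lra.
  rewrite (Rintegral_cat cfd xk0 xkk) big_ord_recr/=.
  have h : - (f (x k.+1) - f (x k)) * psi (x k.+1) <= `|f (x k.+1) - f (x k)|.
    apply: le_trans (ler_norm _) _; rewrite normrM normrN.
    by rewrite ler_piMr.
  have -> : k.+1%:R / N%:R = k%:R / N%:R + N%:R^-1 :> R by rewrite -natr1 mulrDl div1r.
  lra.
have := key N (leqnn N).
by rewrite /x divff ?gt_eqF// psi1 !mulr0 add0r mulr1.
Qed.

End Line.

(** * Triangles *)

Section Hull.
Context {R : realType}.
Implicit Types (p q a b c : R * R) (T : @triangle R).

Definition cross p q : R := p.1 * q.2 - p.2 * q.1.

Lemma tupleE3 T : (T : seq (R * R)) = [:: T`_0; T`_1; T`_2].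
Proof. by case: T => -[|a [|b [|c [|]]]]. Qed.

Lemma convex_hull3P a b c p : convex_hull [:: a; b; c] p <->
  exists s t : R, [/\ 0 <= s, 0 <= t, s + t <= 1 & p = a + s *: (b - a) + t *: (c - a)].
Proof.
split.
- move=> [w [w0]]; rewrite !big_ord_recl !big_ord0/= addr0 => w1 ->.
  exists (w (lift ord0 ord0)), (w (lift ord0 (lift ord0 ord0))); split => //.
    by have := w0 ord0; lra.
  have -> : w ord0 = 1 - w (lift ord0 ord0) - w (lift ord0 (lift ord0 ord0)) by lra.
  by apply/pair_equal_spec; split => /=; rewrite /GRing.scale/=; ring.
- move=> [s [t [s0 t0 st ->]]].
  exists (fun i => nth 0 [:: 1 - s - t; s; t] i); split.
  + by case=> -[|[|[|//]]] ? //=; lra.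
  + by rewrite !big_ord_recl !big_ord0/=; ring.
  + rewrite !big_ord_recl !big_ord0/=.
    by apply/pair_equal_spec; split => /=; rewrite /GRing.scale/=; ring.
Qed.

Lemma hullP T p : convex_hull T p <->
  exists s t : R, [/\ 0 <= s, 0 <= t, s + t <= 1 &
    p = T`_0 + s *: (T`_1 - T`_0) + t *: (T`_2 - T`_0)].
Proof. by rewrite [X in convex_hull X]tupleE3 convex_hull3P. Qed.

(** Twice the signed planar area of [T]. *)
Definition tdet T : R := cross (T`_1 - T`_0) (T`_2 - T`_0).

Lemma nondegenerateE T : nondegenerate T = (tdet T != 0).
Proof. by []. Qed.

Definition ymin T : R := Num.min (T`_0).2 (Num.min (T`_1).2 (T`_2).2).
Definition ymax T : R := Num.max (T`_0).2 (Num.max (T`_1).2 (T`_2).2).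

Lemma hull_y T p : convex_hull T p -> ymin T <= p.2 <= ymax T.
Proof.
move=> /hullP[s [t [s0 t0 st ->]]] /=; rewrite /GRing.scale/=.
have : ymin T <= (T`_0).2 /\ (T`_0).2 <= ymax T by rewrite ge_min le_max !lexx.
have : ymin T <= (T`_1).2 /\ (T`_1).2 <= ymax T.
  by rewrite !ge_min !le_max !lexx !orbT.
have : ymin T <= (T`_2).2 /\ (T`_2).2 <= ymax T.
  by rewrite !ge_min !le_max !lexx !orbT.
move: (ymin T) (ymax T) (T`_0).2 (T`_1).2 (T`_2).2 => m M a b c [a1 a2] [b1 b2] [c1 c2].
by apply/andP; split; nra.
Qed.

Lemma height_gt0 T : nondegenerate T -> ymin T < ymax T.
Proof.
rewrite nondegenerateE; apply: contraNT; rewrite -leNgt => h.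
have : ymin T <= (T`_0).2 /\ (T`_0).2 <= ymax T by rewrite ge_min le_max !lexx.
have : ymin T <= (T`_1).2 /\ (T`_1).2 <= ymax T.
  by rewrite !ge_min !le_max !lexx !orbT.
have : ymin T <= (T`_2).2 /\ (T`_2).2 <= ymax T.
  by rewrite !ge_min !le_max !lexx !orbT.
move=> ? ? ?; rewrite /tdet /cross /=.
have -> : (T`_2).2 = (T`_0).2 by lra.
have -> : (T`_1).2 = (T`_0).2 by lra.
by rewrite !subrr mulr0 mul0r subrr.
Qed.

(* The determinant of [p - q] with any edge is at most [tdet T] in absolute
   value, and some edge spans the height of [T]. *)
Lemma hull_width T p q : convex_hull T p -> convex_hull T q -> p.2 = q.2 ->
  `|p.1 - q.1| * (ymax T - ymin T) <= `|tdet T|.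
Proof.
move=> /hullP[s [t [s0 t0 st ->]]] /hullP[s' [t' [s'0 t'0 st' ->]]] /=.
rewrite /GRing.scale/= /tdet /cross /ymax /ymin/=.
case: (T`_0) (T`_1) (T`_2) => [a1 a2] [b1 b2] [c1 c2] /= e.
have e' : (s - s') * (b2 - a2) + (t - t') * (c2 - a2) = 0 by lra.
have -> : a1 + s * (b1 - a1) + t * (c1 - a1) - (a1 + s' * (b1 - a1) + t' * (c1 - a1)) =
  (s - s') * (b1 - a1) + (t - t') * (c1 - a1) by ring.
have [S1 S2] : -1 <= s - s' /\ s - s' <= 1 by lra.
have [T1 T2] : -1 <= t - t' /\ t - t' <= 1 by lra.
have [U1 U2] : -1 <= (s - s') + (t - t') /\ (s - s') + (t - t') <= 1 by lra.
move: (s - s') (t - t') e' S1 S2 T1 T2 U1 U2 => {e s0 t0 st s'0 t'0 st'} S V e S1 S2 T1 T2 U1 U2.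
pose x := S * (b1 - a1) + V * (c1 - a1).
pose det := (b1 - a1) * (c2 - a2) - (b2 - a2) * (c1 - a1).
rewrite -/x -/det.
have h1 : `|x * (c2 - a2)| <= `|det|.
  have -> : x * (c2 - a2) = S * det + (c1 - a1) * (S * (b2 - a2) + V * (c2 - a2)).
    by rewrite /x /det; ring.
  by rewrite e mulr0 addr0 normrM ler_piMl// ler_norml; lra.
have h2 : `|x * (b2 - a2)| <= `|det|.
  have -> : x * (b2 - a2) = (- V) * det + (b1 - a1) * (S * (b2 - a2) + V * (c2 - a2)).
    by rewrite /x /det; ring.
  by rewrite e mulr0 addr0 normrM ler_piMl// ler_norml; lra.
have h3 : `|x * (c2 - b2)| <= `|det|.
  have -> : x * (c2 - b2) = (S + V) * det + (c1 - b1) * (S * (b2 - a2) + V * (c2 - a2)).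
    by rewrite /x /det; ring.
  by rewrite e mulr0 addr0 normrM ler_piMl// ler_norml; lra.
suff : Num.max a2 (Num.max b2 c2) - Num.min a2 (Num.min b2 c2) \in
    [:: `|c2 - a2|; `|b2 - a2|; `|c2 - b2|].
  by rewrite !inE => /or3P[] /eqP ->; rewrite -normrM.
have nn (z w : R) : z <= w -> `|w - z| = w - z by move=> ?; rewrite ger0_norm// subr_ge0.
have nn' (z w : R) : z <= w -> `|z - w| = w - z by move=> ?; rewrite distrC nn.
have [ab|ab] := leP a2 b2; have [bc|bc] := leP b2 c2; have [ac|ac] := leP a2 c2;
  rewrite !inE /Order.max /Order.min.
all: repeat match goal with 
  | |- context[if (?u < ?v) then _ else _] => case: (ltP u v) => ? end.
all: rewrite ?(nn _ _ ab) ?(nn' _ _ (ltW ab)) ?(nn _ _ bc) ?(nn' _ _ (ltW bc)) ?(nn _ _ ac) ?(nn' _ _ (ltW ac)).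
all: apply/or3P.
all: first [constructor 1; apply/eqP; lra | constructor 2; apply/eqP; lra | constructor 3; apply/eqP; lra].
Qed.

Lemma barycentric T p : nondegenerate T ->
  p = T`_0 + (cross (p - T`_0) (T`_2 - T`_0) / tdet T) *: (T`_1 - T`_0)
           + (cross (T`_1 - T`_0) (p - T`_0) / tdet T) *: (T`_2 - T`_0).
Proof.
rewrite nondegenerateE /tdet /cross; move: (T`_1 - T`_0) (T`_2 - T`_0) => B C.
case: p (T`_0) => [p1 p2] [a1 a2] /= d.
by apply/pair_equal_spec; split => /=; rewrite /GRing.scale/=; field.
Qed.

Lemma barycentric_uniq T p (s t : R) : nondegenerate T ->
  p = T`_0 + s *: (T`_1 - T`_0) + t *: (T`_2 - T`_0) ->
  s = cross (p - T`_0) (T`_2 - T`_0) / tdet T /\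
  t = cross (T`_1 - T`_0) (p - T`_0) / tdet T.
Proof.
rewrite nondegenerateE /tdet /cross => + ->; move: (T`_1 - T`_0) (T`_2 - T`_0) => B C.
case: (T`_0) => [a1 a2] /= d.
by split => /=; rewrite /GRing.scale/=; field.
Qed.

(** By Cramer's rule the two barycentric coordinates of (x, y) are continuous in x, and the slice is
    where they and their complement to 1 are nonnegative. *)
Lemma slice_closed T (y : R) : nondegenerate T -> closed [set x | convex_hull T (x, y)].
Proof.
move=> dT.
pose s (x : R) : R := cross ((x, y) - T`_0) (T`_2 - T`_0) / tdet T.
pose t (x : R) : R := cross (T`_1 - T`_0) ((x, y) - T`_0) / tdet T.
have c1 : continuous (fun x : R => ((x, y) - T`_0).1).
  by move=> x; apply: cvgB; [exact: cvg_id|exact: cvg_cst].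
have c2 : continuous (fun x : R => ((x, y) - T`_0).2).
  by move=> x; apply: (@cvg_cst R^o (y - (T`_0).2)).
have cc (r : R) : continuous (fun x : R => r) by move=> x; exact: cvg_cst.
have cs : continuous s.
  apply: (continuous_mulr _ (cc _)).
  exact: (continuous_subr (continuous_mulr c1 (cc _)) (continuous_mulr c2 (cc _))).
have ct : continuous t.
  apply: (continuous_mulr _ (cc _)).
  exact: (continuous_subr (continuous_mulr (cc _) c2) (continuous_mulr (cc _) c1)).
have cst : continuous (fun x => 1 - s x - t x).
  apply: (@continuous_subr R R (fun x => 1 - s x) t) => //.
  by apply: (@continuous_subr R R (fun=> 1) s).
have cl (f : R -> R) : continuous f -> closed (f @^-1` [set z | 0 <= z]).
  by move/continuous_closedP => cf; apply: (cf [set z | 0 <= z]); exact: closed_ge.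
have -> : [set x | convex_hull T (x, y)] =
    (s @^-1` [set z | 0 <= z]) `&` (t @^-1` [set z | 0 <= z])
    `&` ((fun x => 1 - s x - t x) @^-1` [set z | 0 <= z]).
  apply/seteqP; split => x.
  - move=> /hullP[a [b [a0 b0 ab /(barycentric_uniq dT)]]] [sE tE].
    by rewrite sE in a0 ab; rewrite tE in b0 ab; split=> [|/=]; [split|rewrite /s /t; lra].
  - move=> [[/= s0 t0] st]; apply/hullP; exists (s x), (t x).
    by split => //; [lra|exact: barycentric].
by apply: closedI; [apply: closedI|]; exact: cl.
Qed.

End Hull.

(** * Variation of a polyhedral surface along horizontal lines *)

Section Cover.
Context {R : realType}.
Implicit Types (p q : R * R) (T : @triangle R) (V : R * R -> R) (D : seq (@triangle R)).
Notation mu := (@lebesgue_measure R).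

(** An inequality is all one gets, since the intervals need not lie inside the unit interval. Here
    [a i] and [b i] will be the extreme heights of a triangle. *)
Lemma step_function_integral (I : Type) (D : seq I) (K a b : I -> R) :
  (forall i, 0 <= K i) -> (forall i, a i <= b i) ->
  let L y := \sum_(i <- D) K i * \1_(`[a i, b i]) y in
  mu.-integrable `]0, 1[ (EFin \o L) /\
  \int[mu]_(y in `]0, 1[) L y <= \sum_(i <- D) K i * (b i - a i).
Proof.
move=> K0 ab L; rewrite {}/L.
have int1 i : mu.-integrable `]0, 1[ (EFin \o (\1_(`[a i, b i]) : R -> R)).
  by apply: integrableS (integrable_indic_itv (a i) (b i) true false).
have intK i : mu.-integrable `]0, 1[ (EFin \o (fun y => K i * \1_(`[a i, b i]) y)).
  apply: (@eq_integrable _ _ _ mu _ _ (fun y => (K i)%:E * (EFin \o \1_(`[a i, b i])) y)%E) => //.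
  exact: integrableZl.
elim: D => [|i D [IH1 IH2]].
  split.
    apply: eq_integrable (integrable0 _ _) => // y _; by rewrite /= big_nil.
  rewrite big_nil; under eq_Rintegral do rewrite big_nil.
  by rewrite Rintegral_cst ?mul0r.
have E : (fun y => \sum_(i <- i :: D) K i * \1_(`[a i, b i]) y) =
         (fun y => K i * \1_(`[a i, b i]) y + \sum_(i <- D) K i * \1_(`[a i, b i]) y).
  by apply/funext => y; rewrite big_cons.
rewrite E; split.
  by apply: eq_integrable (integrableD _ (intK i) IH1).
rewrite RintegralD// big_cons lerD// RintegralZl//.
rewrite ler_wpM2l// /Rintegral integral_indic//.
rewrite -lee_fin fineK; last first.
  apply/fin_numPlt; rewrite (lt_le_trans _ (measure_ge0 _ _))//=.
  apply: (@le_lt_trans _ _ (mu `[a i, b i])); first by apply: le_measure; rewrite ?inE//; exact: measurableI.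
  by rewrite lebesgue_measure_itv/=; case: ifP => _; rewrite ?ltry// -EFinD ltry.
apply: (@le_trans _ _ (mu `[a i, b i])); first by apply: le_measure; rewrite ?inE//; exact: measurableI.
rewrite lebesgue_measure_itv/= lte_fin; case: ifP => _; first by rewrite -EFinB.
by rewrite lee_fin subr_ge0.
Qed.

Lemma mem_hull0 T : convex_hull T T`_0.
Proof. by apply/hullP; exists 0, 0; split; rewrite ?scale0r ?addr0. Qed.

Lemma mem_hull1 T : convex_hull T T`_1.
Proof.
apply/hullP; exists 1, 0; split=> //.
by rewrite scale0r scale1r addr0 addrC subrK.
Qed.

Lemma mem_hull2 T : convex_hull T T`_2.
Proof.
apply/hullP; exists 0, 1; split=> //.
by rewrite scale0r scale1r addr0 addrC subrK.
Qed.

(** Up to sign, [a * tdet T] is one component of the cross product of two edges of the lifted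
    triangle, and the norm of that product is twice the area. *)
Lemma slope_det_le_area T V (a b c : R) :
  (forall p, convex_hull T p -> V p = a * p.1 + b * p.2 + c) ->
  `|a| * `|tdet T| <= 2 * triangle_area3 (T`_0, V T`_0) (T`_1, V T`_1) (T`_2, V T`_2).
Proof.
move=> hV; rewrite hV; last exact: mem_hull0.
rewrite hV; last exact: mem_hull1.
rewrite hV; last exact: mem_hull2.
rewrite /triangle_area3 mulrCA divff// mulr1 -normrM -sqrtr_sqr.
apply: ler_wsqrtr.
rewrite /tdet /cross /=; case: (T`_0) (T`_1) (T`_2) => [a1 a2] [b1 b2] [c1 c2] /=.
set X := (X in X ^+ 2 <= _); set Y := (Y in _ <= Y ^+ 2 + _ + _).
have -> : X = - Y by rewrite /X /Y; ring.
by rewrite sqrrN -addrA lerDl addr_ge0// sqr_ge0.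
Qed.

(** What the upper bound on the variation needs of an inscribed surface. The way in which triangles
    meet is dropped and [V] is continuous on the whole plane, so the notion is easily transported by
    the reflection in the diagonal. *)
Definition cover_surface D V (M : R) : Prop :=
  [/\ {in D, forall T, nondegenerate T},
      unit_square = \bigcup_(T in [set` D]) convex_hull T,
      continuous V,
      {in D, forall T, affine_on (convex_hull T) V}
    & polyhedral_area D V <= M].

Definition sum_incr (f : R -> R) (N : nat) : R :=
  \sum_(k < N) `|f (k.+1%:R / N%:R) - f (k%:R / N%:R)|.

(** Truncation of the identity to [z - r, z + r]. It is nondecreasing, grows by at most 2r in all,
    and is the identity on every set within r of z; hence it can stand for the slice of a triangle
    of which only one point and a bound on the width are known. *)
Definition clampr (z r x : R) : R := Num.max (z - r) (Num.min x (z + r)).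

Lemma clampr_id z r x : `|x - z| <= r -> clampr z r x = x.
Proof.
rewrite ler_norml => h; rewrite /clampr min_l; last lra.
by rewrite max_r//; lra.
Qed.

Lemma clampr_homo z r x y : x <= y -> clampr z r x <= clampr z r y.
Proof.
move=> xy; rewrite /clampr ge_max !le_max lexx/=; apply/orP; right.
by rewrite le_min !ge_min xy lexx orbT.
Qed.

Lemma clampr_itv z r x : 0 <= r -> z - r <= clampr z r x <= z + r.
Proof.
move=> r0; rewrite /clampr le_max lexx/= ge_max ge_min lexx orbT andbT.
by lra.
Qed.

Lemma continuous_clampr z r : continuous (clampr z r).
Proof.
apply: continuous_maxr; first by move=> x; exact: cvg_cst.
by apply: continuous_minr; [move=> x; exact: cvg_id|move=> x; exact: cvg_cst].
Qed.

(** On a fixed line the increments of [V] are dominated by those of [G], a sum over the triangles of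
    |slope| times a truncated identity; these telescope, so the bound [L] does not depend on [N].
    The factor 4 is 2 * 2: a truncation grows by up to twice the width bound [r T], and |slope| *
    |det| is at most twice the area. *)
Lemma cover_line_bound D V M : cover_surface D V M ->
  exists L : R -> R, [/\ mu.-integrable `]0, 1[ (EFin \o L),
    \int[mu]_(y in `]0, 1[) L y <= 4 * M
  & forall N (y : R), (0 < N)%N -> 0 <= y <= 1 -> sum_incr (fun x => V (x, y)) N <= L y].
Proof.
move=> [nd cov cV aff area].
have /choice[al hal] : forall T, exists a : R, T \in D ->
    exists b c, forall p, convex_hull T p -> V p = a * p.1 + b * p.2 + c.
  move=> T; have [TD|] := boolP (T \in D); last by exists 0.
  by have [a [b [c h]]] := aff T TD; exists a => _; exists b, c.
pose r T : R := `|tdet T| / (ymax T - ymin T).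
have h0 T : ymin T <= ymax T.
  by have /andP[] := hull_y (mem_hull0 T); exact: le_trans.
have r0 T : 0 <= r T by rewrite divr_ge0// subr_ge0.
pose K T : R := `|al T| * (2 * r T).
have K0 T : 0 <= K T by rewrite mulr_ge0// mulr_ge0.
have [iL intL] := step_function_integral D K0 h0.
exists (fun y => \sum_(T <- D) K T * \1_(`[ymin T, ymax T]) y); split => //.
  apply: le_trans intL _; apply: le_trans (_ : 4 * polyhedral_area D V <= _); last by rewrite ler_wpM2l.
  rewrite /polyhedral_area mulr_sumr big_seq [leRHS]big_seq; apply: ler_sum => T TD.
  have [b [c hV]] := hal T TD.
  have := slope_det_le_area hV.
  have -> : K T * (ymax T - ymin T) = 2 * (`|al T| * `|tdet T|).
    have := height_gt0 (nd T TD); rewrite -subr_gt0 => h.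
    by rewrite /K /r; field; rewrite gt_eqF.
  lra.
move=> N y N0 y01.
(* Any point of the slice will do. The default value for triangles that miss the line is harmless:
   their terms in [G] are nondecreasing and grow by at most 2r whatever [z T] is. *)
pose z T : R := xget 0 [set x | convex_hull T (x, y)].
pose G (x : R) : R := \sum_(T <- D) \1_(`[ymin T, ymax T]) y * (`|al T| * clampr (z T) (r T) x).
have cG : continuous G.
  apply: continuous_sumr => T.
  apply: continuous_mulr; first by move=> x; exact: cvg_cst.
  apply: continuous_mulr; first by move=> x; exact: cvg_cst.
  exact: continuous_clampr.
have cVy : continuous (fun x => V (x, y)) by exact: continuous_line.
have i01 T : 0 <= \1_(`[ymin T, ymax T]) y :> R by rewrite indicE; case: (_ \in _).
have incr T (x x' : R) : T \in D -> x <= x' -> convex_hull T (x, y) -> convex_hull T (x', y) ->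
    `|V (x', y) - V (x, y)| <= G x' - G x.
  move=> TD xx' hx hx'.
  have [b [c hV]] := hal T TD.
  have hz : convex_hull T (z T, y) by have := @xgetPex _ 0 [set x | convex_hull T (x, y)]; apply; exists x.
  have := height_gt0 (nd T TD); rewrite -subr_gt0 => hT.
  have zr w : convex_hull T (w, y) -> `|w - z T| <= r T.
    by move=> hw; rewrite /r ler_pdivlMr//; exact: (hull_width hw hz).
  have -> : V (x', y) - V (x, y) = al T * (x' - x) by rewrite !hV//=; ring.
  rewrite normrM (ger0_norm (_ : 0 <= x' - x)) ?subr_ge0//.
  rewrite /G -sumrB (big_rem T)//=.
  have -> : \1_(`[ymin T, ymax T]) y = 1 :> R.
    by rewrite indicE mem_set//= in_itv/=; exact: (hull_y hz).
  rewrite !clampr_id; try exact: zr.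
  rewrite !mul1r -mulrBr lerDl; apply: sumr_ge0 => S _.
  by rewrite -mulrBr mulr_ge0// -mulrBr mulr_ge0// subr_ge0 clampr_homo.
(* For [e] equal to 1 and -1 this bounds the increment of [V] on both sides by that of [G]. *)
have mono (e x x' : R) : `|e| <= 1 -> 0 <= x -> x <= x' -> x' <= 1 ->
    G x + e * V (x, y) <= G x' + e * V (x', y).
  move=> e1 x0 xx' x'1.
  apply: (@monotone_on_cover _ _ D (fun T => [set x | convex_hull T (x, y)])
    (fun x => G x + e * V (x, y))) => //.
  - apply: continuous_addr => //; apply: continuous_mulr => //.
    by move=> t; exact: cvg_cst.
  - by move=> T TD; apply: slice_closed; exact: nd.
  - move=> t tx.
    have : unit_square (t, y) by apply/unit_squareP; split => //=; lra.
    by rewrite cov => -[T /= TD ht]; exists T.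
  - move=> T t t' TD _ tt' _ ht ht'.
    have := incr T t t' TD tt' ht ht'.
    have : `|e * (V (t', y) - V (t, y))| <= `|V (t', y) - V (t, y)|.
      by rewrite normrM ler_piMl.
    by rewrite ler_norml => /andP[]; lra.
have NR0 : 0 < N%:R :> R by rewrite ltr0n.
apply: (@le_trans _ _ (\sum_(k < N) (G (k.+1%:R / N%:R) - G (k%:R / N%:R)))).
  apply: ler_sum => k _.
  have k0 : 0 <= k%:R / N%:R :> R by rewrite divr_ge0// ltW.
  have kk : k%:R / N%:R <= k.+1%:R / N%:R :> R.
    by rewrite ler_pM2r ?invr_gt0// ler_nat.
  have k1 : k.+1%:R / N%:R <= 1 :> R by rewrite ler_pdivrMr// mul1r ler_nat.
  have := mono 1 _ _ _ k0 kk k1; rewrite normr1 lexx => /(_ isT) m1.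
  have := mono (-1) _ _ _ k0 kk k1; rewrite normrN1 lexx => /(_ isT) m2.
  by rewrite ler_norml; lra.
rewrite -(big_mkord xpredT (fun k => G (k.+1%:R / N%:R) - G (k%:R / N%:R))).
rewrite (@telescope_sumr _ 0 N (fun k => G (k%:R / N%:R)))//.
rewrite divff ?gt_eqF// mul0r /G -sumrB; apply: ler_sum => T _.
rewrite -mulrBr mulrC ler_wpM2r// -mulrBr /K ler_wpM2l//.
have /andP[_ c1] := clampr_itv (z T) 1 (r0 T).
have /andP[c0 _] := clampr_itv (z T) 0 (r0 T).
lra.
Qed.

End Cover.

(** * Finite relaxed area implies bounded variation *)

Section RelaxedToBV.
Context {R : realType}.
Implicit Types (p q : R * R) (T : @triangle R) (V U u v : R * R -> R) (D : seq (@triangle R)).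
Notation mu := (@lebesgue_measure R).
Notation S := (@unit_square R)^°.

Lemma enorm_ge1 p : `|p.1| <= enorm p.
Proof. by rewrite /enorm -sqrtr_sqr ler_wsqrtr// lerDl sqr_ge0. Qed.

Lemma enorm_ge2 p : `|p.2| <= enorm p.
Proof. by rewrite /enorm -sqrtr_sqr ler_wsqrtr// lerDr sqr_ge0. Qed.

Lemma enorm_le p : enorm p <= `|p.1| + `|p.2|.
Proof.
rewrite -(ger0_norm (addr_ge0 (normr_ge0 p.1) (normr_ge0 p.2))) -sqrtr_sqr.
apply: ler_wsqrtr; rewrite sqrrD !real_normK ?num_real//.
have := mulr_ge0 (normr_ge0 p.1) (normr_ge0 p.2); move: (_ * _) => z z0.
rewrite -mulr_natl; lra.
Qed.

Lemma enorm_square p q : unit_square p -> unit_square q -> enorm (p - q) <= 2.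
Proof.
move=> /unit_squareP[p1 p2] /unit_squareP[q1 q2].
apply: le_trans (enorm_le _) _ => /=.
have -> : 2 = 1 + 1 :> R by [].
by apply: lerD; rewrite ler_norml; lra.
Qed.

Lemma diam_le (A : set (R * R)) (r : R) : A !=set0 ->
  (forall p q, A p -> A q -> enorm (p - q) <= r) -> diam A <= r.
Proof.
move=> [p Ap] h; apply: ge_sup; first by exists (enorm (p - p)); exists (p, p).
by move=> _ [[a b] [/= Aa Ab] <-]; exact: h.
Qed.

(** [diam] and [mesh] are suprema of real sets and are informative only for bounded ones; the crude
    bound 2 on distances in the square provides the boundedness. *)
Lemma hull_dist_le_mesh D T p q : unit_square = \bigcup_(T in [set` D]) convex_hull T ->
  T \in D -> convex_hull T p -> convex_hull T q -> enorm (p - q) <= mesh D.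
Proof.
move=> cov TD hp hq.
have sub T' a : T' \in D -> convex_hull T' a -> unit_square a.
  by move=> T'D ha; rewrite cov; exists T'.
apply: (@le_trans _ _ (diam (convex_hull T))).
  apply: sup_upper_bound; last by exists (p, q).
  split; first by exists (enorm (p - q)); exists (p, q).
  exists 2 => _ [[a b] [/= ha hb] <-].
  by apply: enorm_square; exact: sub TD _.
apply: sup_upper_bound; last by exists T.
split; first by exists (diam (convex_hull T)); exists T.
exists 2 => _ [T' /= T'D <-]; apply: diam_le.
  by exists T'`_0; exact: mem_hull0.
by move=> a b ha hb; apply: enorm_square; exact: sub T'D _.
Qed.

Lemma affine_on_hull T V (a b c : R) s t :
  (forall p, convex_hull T p -> V p = a * p.1 + b * p.2 + c) ->
  0 <= s -> 0 <= t -> s + t <= 1 ->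
  V (T`_0 + s *: (T`_1 - T`_0) + t *: (T`_2 - T`_0)) =
  (1 - s - t) * V T`_0 + s * V T`_1 + t * V T`_2.
Proof.
move=> hV s0 t0 st; rewrite hV; last by apply/hullP; exists s, t.
rewrite hV; last exact: mem_hull0.
rewrite hV; last exact: mem_hull1.
rewrite hV; last exact: mem_hull2.
by rewrite /= /GRing.scale/=; ring.
Qed.

(** On a triangle containing [p], [v p] is a convex combination of the values of [u] at the
    vertices, and each of these is within [e] of [U p] because the triangle has diameter less than
    [d]. *)
Lemma interpolant_close D u v U (d e : R) : unit_square = \bigcup_(T in [set` D]) convex_hull T ->
  interpolates unit_square u D v -> (forall p, unit_square p -> U p = u p) ->
  (forall p q, unit_square p -> `|p.1 - q.1| < d -> `|p.2 - q.2| < d -> `|U p - U q| < e) ->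
  mesh D < d -> forall p, unit_square p -> `|v p - U p| <= e.
Proof.
move=> cov [_ aff vtx] Uu osc md p Qp.
have [T /= TD hp] : (\bigcup_(T in [set` D]) convex_hull T) p by rewrite -cov.
have near q : convex_hull T q -> v q = u q -> `|v q - U p| <= e.
  move=> hq ->; rewrite -Uu; last by rewrite cov; exists T.
  have := hull_dist_le_mesh cov TD hp hq.
  move=> h; rewrite distrC ltW//; apply: osc => //.
    by apply: le_lt_trans (le_trans (enorm_ge1 (p - q)) h) md.
  by apply: le_lt_trans (le_trans (enorm_ge2 (p - q)) h) md.
have memT (i : nat) : (i < 3)%N -> T`_i \in (T : seq _) by move=> ?; rewrite mem_nth// size_tuple.
have n0 := near _ (mem_hull0 T) (vtx T TD _ (memT 0 isT)).
have n1 := near _ (mem_hull1 T) (vtx T TD _ (memT 1 isT)).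
have n2 := near _ (mem_hull2 T) (vtx T TD _ (memT 2 isT)).
have [a [b [c hv]]] := aff T TD.
have /hullP[s [t [s0 t0 st pE]]] := hp.
rewrite {1}pE (affine_on_hull hv s0 t0 st).
move: n0 n1 n2; rewrite !ler_norml.
move: (v T`_0) (v T`_1) (v T`_2) (U p) => v0 v1 v2 w /andP[? ?] /andP[? ?] /andP[? ?].
by apply/andP; split; nra.
Qed.

Lemma cover_surface_ext D u v : is_triangulation unit_square D ->
  interpolates unit_square u D v -> cover_surface D (ext v) (polyhedral_area D v).
Proof.
move=> [nd cov _ _] [cv aff _].
have sub T a : T \in D -> convex_hull T a -> unit_square a.
  by move=> TD ha; rewrite cov; exists T.
split => //.
- exact: ext_continuous.
- move=> T TD; have [a [b [c h]]] := aff T TD.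
  by exists a, b, c => p hp; rewrite ext_id ?h//; exact: sub hp.
rewrite /polyhedral_area big_seq [leRHS]big_seq le_eqVlt; apply/orP; left; apply/eqP.
apply: eq_bigr => T TD; rewrite !ext_id//.
- exact: sub TD (mem_hull2 T).
- exact: sub TD (mem_hull1 T).
- exact: sub TD (mem_hull0 T).
Qed.

Lemma relaxed_area_approx u : {within unit_square, continuous u} ->
  (relaxed_area u unit_square < +oo)%E ->
  exists M : R, forall e : R, 0 < e -> exists D V, cover_surface D V M /\
    forall p, unit_square p -> `|V p - ext u p| <= e.
Proof.
move=> cu fin_area.
have [P [tri int ms] lim] : exists2 P : nat -> seq (@triangle R) * (R * R -> R),
    [/\ forall h, is_triangulation unit_square (P h).1,
        forall h, interpolates unit_square u (P h).1 (P h).2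
      & mesh (P h).1 @[h --> \oo] --> (0 : R)] &
    (limn_einf (fun h => (polyhedral_area (P h).1 (P h).2)%:E) < +oo)%E.
  apply: contrapT => no; move: fin_area; rewrite ltNge => /negP; apply.
  apply: le_ereal_inf_tmp => _ [P HP <-]; rewrite leNgt; apply/negP => lt.
  by apply: no; exists P.
(* A real number strictly above the lower limit, so that areas at most [M] recur beyond every index
   and one of them can be matched with a small mesh. The same [M] serves for every [e]. *)
have [M limM] : exists M : R, (limn_einf (fun h => (polyhedral_area (P h).1 (P h).2)%:E) < M%:E)%E.
  move: lim; case: limn_einf => [r _|//|_]; last by exists 0; rewrite ltNyr.
  by exists (r + 1); rewrite lte_fin ltrDl.
exists M => e e0.
have [d d0 osc] := continuous_unif (ext_continuous cu) e0.
have : \forall h \near \oo, mesh (P h).1 < d by move/cvgr_lt : ms; exact.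
move=> [n _ hn].
have [h [nh hM]] : exists h, (n <= h)%N /\ polyhedral_area (P h).1 (P h).2 <= M.
  apply: contrapT => no; move: limM; rewrite ltNge => /negP; apply.
  rewrite limn_einf_lim; apply: (@le_trans _ _ (einfs (fun h => (polyhedral_area (P h).1 (P h).2)%:E) n)).
    apply: le_ereal_inf_tmp => _ [k /= nk <-]; rewrite lee_fin leNgt; apply/negP => lt.
    by apply: no; exists k; split; [exact: nk|exact: ltW].
  rewrite (cvg_lim _ (@cvg_einfs_sup _ _))//.
  by apply: ereal_sup_ubound; exists n.
exists (P h).1, (ext (P h).2); split.
  by have [? ? ? ? /le_trans h1] := cover_surface_ext (tri h) (int h); split => //; exact: h1.
move=> p Qp; rewrite [ext (P h).2 p]ext_id//.
have [_ cov _ _] := tri h.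
apply: (interpolant_close cov (int h) (fun p => @ext_id _ u p) osc) => //.
exact: hn.
Qed.

Lemma dx_line (phi : R * R -> R) (x y : R) :
  (derivable phi (x, y) (1, 0) = derivable (fun t => phi (t, y)) x 1) *
  (dx phi (x, y) = 'D_1 (fun t => phi (t, y)) x).
Proof.
have E : (fun h : R => h^-1 *: (((fun t : R => phi (t, y)) \o shift x) (h *: (1:R)) - phi (x, y))) =
    (fun h : R => h^-1 *: ((phi \o shift (x, y)) (h *: ((1, 0) : R * R)) - phi (x, y))).
  apply/funext => h /=; congr (_ *: (phi _ - _)).
  by apply/pair_equal_spec; split => //=; rewrite scaler0 add0r.
by split; [rewrite /derivable/= E|rewrite /dx /derive/= E].
Qed.

Lemma is_derive_line (phi : R * R -> R) (x y : R) : derivable phi (x, y) (1, 0) ->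
  is_derive x 1 (fun t => phi (t, y)) (dx phi (x, y)).
Proof. by rewrite !dx_line => /derivableP. Qed.

(** The order of choices matters: [K] bounds [dx phi], then [N] makes [U] oscillate by at most
    1/(K+1) over a step, and only then is a surface taken within 1/(2N) of [U]. Freezing [U] on the
    steps costs at most 1, and replacing the [N] increments of [U] by those of [V] costs 1/N each,
    hence the term 2. *)
Lemma line_variation_bound U (M : R) (phi : R * R -> R) : continuous U ->
  (forall e : R, 0 < e -> exists D V, cover_surface D V M /\
    forall p, unit_square p -> `|V p - U p| <= e) ->
  (forall p, derivable phi p (1, 0)) -> continuous (dx phi) ->
  (forall p, ~ S p -> phi p = 0) -> (forall p, `|phi p| <= 1) ->
  sq_int (fun p => U p * dx phi p) <= 4 * M + 2.
Proof.
move=> cU app dphi cdphi supp phi1.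
have [K K0 hK] := continuous_bounded cdphi.
have K10 : 0 < (K + 1)^-1 by rewrite invr_gt0; lra.
have [d d0 osc] := continuous_unif cU K10.
have [k] := ltr_add_invr d0; rewrite add0r => kd.
pose N := k.+1.
have NR0 : 0 < N%:R :> R by rewrite ltr0n.
have e0 : 0 < (2 * N%:R)^-1 :> R by rewrite invr_gt0 mulr_gt0.
have [D [V [cs clo]]] := app _ e0.
have [L [iL intL lineL]] := cover_line_bound cs.
have cUd := continuous_mulr cU cdphi.
have i2 : mu.-integrable `]0, 1[ (EFin \o (fun=> 2 : R)).
  apply: integrableS (_ : mu.-integrable `[0, 1] _) => //; first exact: subset_itv_oo_cc.
  by apply: integrable_itv => x; exact: cvg_cst.
apply: (@le_trans _ _ (\int[mu]_(y in `]0, 1[) (L y + 2))); last first.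
  rewrite RintegralD// lerD// Rintegral_cst//= lebesgue_measure_itv/= lte_fin ltr01 -EFinB/=.
  by rewrite subr0 mulr1.
apply: sq_int_le_iterated => //.
  by apply: eq_integrable (integrableD _ iL i2).
move=> y y01.
(* The vertical sides lie outside the open square, so [phi] vanishes at both ends of every
   horizontal line, as the summation by parts requires. *)
have nS x : x = 0 \/ x = 1 -> ~ S (x, y).
  by rewrite interior_unit_square => -[]-> [/=]; rewrite in_itv/= ltxx ?andbF.
apply: (@le_trans _ _ (sum_incr (fun x => U (x, y)) N + (K + 1)^-1 * K)).
  apply: (@line_ibp _ (fun x => U (x, y)) (fun x => phi (x, y)) (fun x => dx phi (x, y))) => //.
  - exact: continuous_line.
  - exact: continuous_line.
  - by move=> x; exact: is_derive_line.
  - exact: ltW.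
  - by apply: supp; apply: nS; left.
  - by apply: supp; apply: nS; right.
  - by move=> x x01; apply: hK; apply/unit_squareP; split => //=; lra.
  move=> x x' x01 x'01 xx'; apply/ltW/osc => /=.
  - by apply/unit_squareP; split => //=; lra.
  - exact: le_lt_trans xx' kd.
  - by rewrite subrr normr0.
have h1 : (K + 1)^-1 * K <= 1 by rewrite mulrC ler_pdivrMr; lra.
have h2 : sum_incr (fun x => U (x, y)) N <= sum_incr (fun x => V (x, y)) N + 1.
  have -> : 1 = \sum_(k < N) N%:R^-1 :> R.
    by rewrite sumr_const card_ord -[RHS]mulr_natl mulfV// gt_eqF.
  rewrite /sum_incr -big_split/=; apply: ler_sum => j _.
  have a01 (i : nat) : (i <= N)%N -> unit_square (i%:R / N%:R, y).
    move=> iN; apply/unit_squareP; split => /=; last lra.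
    by rewrite divr_ge0//= ?ler_pdivrMr ?mul1r ?ler_nat// ltW.
  have Ne : (2 * N%:R)^-1 + (2 * N%:R)^-1 = N%:R^-1 :> R by field; rewrite gt_eqF.
  have tri (a b a' b' r : R) : `|b - a| <= r -> `|b' - a'| <= r ->
      `|a - a'| <= `|b - b'| + (r + r).
    move=> h h'; have -> : a - a' = - (b - a) + (b - b') + (b' - a') by ring.
    apply: le_trans (ler_normD _ _) _; have := ler_normD (- (b - a)) (b - b').
    by rewrite normrN; lra.
  have := tri _ _ _ _ _ (clo _ (a01 j.+1 (ltn_ord j))) (clo _ (a01 j (ltnW (ltn_ord j)))).
  by rewrite Ne.
have h3 : sum_incr (fun x => V (x, y)) N <= L y by apply: lineL => //; lra.
lra.
Qed.

Definition swapt T : triangle := map_tuple swap T.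

Lemma swaptE T (i : nat) : (i < 3)%N -> (swapt T)`_i = swap T`_i.
Proof. by move=> i3; rewrite /= (nth_map 0)// size_tuple. Qed.

Lemma swapK p : swap (swap p) = p. Proof. by case: p. Qed.

Lemma hull_swapt T p : convex_hull (swapt T) p <-> convex_hull T (swap p).
Proof.
have lin (s t : R) (a b c : R * R) : swap a + s *: (swap b - swap a) + t *: (swap c - swap a) =
    swap (a + s *: (b - a) + t *: (c - a)) by [].
rewrite !hullP !swaptE//.
split=> -[s [t [s0 t0 st pE]]]; exists s, t; split => //.
  by rewrite pE lin swapK.
by rewrite lin -pE swapK.
Qed.

(** Reflection in the diagonal reduces the y-derivative to the x-derivative. It only permutes the
    components of the cross products, up to sign, so areas are unchanged. *)
Lemma cover_surface_swap D V (M : R) : cover_surface D V M ->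
  cover_surface (map swapt D) (V \o swap) M.
Proof.
move=> [nd cov cV aff area]; split.
- move=> _ /mapP[T TD ->]; have := nd T TD.
  rewrite !nondegenerateE /tdet /cross !swaptE//; apply: contra_neq => /= h.
  by rewrite -[RHS]oppr0 -h; ring.
- apply/seteqP; split => p.
    move=> Qp; have : unit_square (swap p) by apply/unit_squareP; have /unit_squareP[] := Qp.
    rewrite cov => -[T /= TD hT]; exists (swapt T) => /=; first exact: map_f.
    exact/hull_swapt.
  move=> [_ /= /mapP[T TD ->]] /hull_swapt hT.
  have : unit_square (swap p) by rewrite cov; exists T.
  by move=> /unit_squareP[? ?]; apply/unit_squareP.
- by move=> p; apply: continuous_comp; [exact: continuous_swap|exact: cV].
- move=> _ /mapP[T TD ->]; have [a [b [c h]]] := aff T TD.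
  exists b, a, c => p /hull_swapt hp; rewrite /= h//=.
  by rewrite [b * _ + _]addrC.
- apply: le_trans area; rewrite /polyhedral_area big_map le_eqVlt; apply/orP; left; apply/eqP.
  apply: eq_bigr => T _; rewrite /triangle_area3 !swaptE//= !swapK.
  by congr (Num.sqrt _ / _); ring.
Qed.

(** The two difference quotients are convertible. *)
Lemma derive_swap (phi : R * R -> R) p : 
  (derivable (phi \o swap) p (1, 0) = derivable phi (swap p) (0, 1)) *
  (dx (phi \o swap) p = dy phi (swap p)).
Proof. by []. Qed.

Lemma relaxed_area_BV u : {within unit_square, continuous u} ->
  (relaxed_area u unit_square < +oo)%E -> BV S u.
Proof.
move=> cu /(relaxed_area_approx cu)[M app].
have cU := ext_continuous cu.
have uE p : S p -> u p = ext u p by move=> /sub_square ?; rewrite ext_id.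
split.
  apply: eq_integrable (integrable_square cU); first exact: measurable_square.
  by move=> p; rewrite inE => Sp /=; rewrite uE.
apply: (@le_lt_trans _ _ (8 * M + 4)%:E); last by rewrite ltry.
apply: ge_ereal_sup => _ [[f g] [/= [[df1 _ cf1 _] [_ dg2 _ cg2]] [_ sf] [_ sg] fg1] <-].
have supp (h : R * R -> R) : closure [set x | h x != 0] `<=` S -> forall p, ~ S p -> h p = 0.
  move=> hS p nSp; apply: contrapT => /eqP hp; apply: nSp; apply: hS.
  exact: subset_closure.
have cUf := continuous_mulr cU cf1.
have cUg := continuous_mulr cU cg2.
have -> : (\int[lebesgue2]_(x in S) (u x * (dx f x + dy g x))%:E)%E =
    (sq_int (fun p => ext u p * dx f p) + sq_int (fun p => ext u p * dy g p))%:E.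
  rewrite -sq_intD// -sq_intE; last exact: continuous_addr.
  by apply: eq_integral => p; rewrite inE => Sp; rewrite uE// mulrDr.
rewrite lee_fin.
have h1 : sq_int (fun p => ext u p * dx f p) <= 4 * M + 2.
  apply: (line_variation_bound cU app df1 cf1 (supp f sf)).
  by move=> p; apply: le_trans (fg1 p); exact: (enorm_ge1 (f p, g p)).
have h2 : sq_int (fun p => ext u p * dy g p) <= 4 * M + 2.
  have cs (h : R * R -> R) : continuous h -> continuous (h \o swap).
    by move=> ch p; apply: continuous_comp; [exact: continuous_swap|exact: ch].
  rewrite -(sq_int_swap cUg).
  have E : dx (g \o swap) = dy g \o swap by apply/funext => p; rewrite derive_swap.
  have := @line_variation_bound (ext u \o swap) M (g \o swap) (cs _ cU).
  rewrite E; apply.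
  - move=> e e0; have [D [V [cD clo]]] := app e e0.
    exists (map swapt D), (V \o swap); split; first exact: cover_surface_swap.
    move=> p Qp; apply: clo; have /unit_squareP[? ?] := Qp; exact/unit_squareP.
  - by move=> p; rewrite derive_swap; exact: dg2.
  - exact: (cs (dy g)).
  - move=> p nSp; apply: (supp g) => //.
    by move: nSp; rewrite interior_unit_square => nSp [/= ? ?]; apply: nSp.
  - by move=> p; apply: le_trans (fg1 (swap p)); exact: (enorm_ge2 (f (swap p), g (swap p))).
have -> : 8 * M + 4 = (4 * M + 2) + (4 * M + 2) by ring.
exact: lerD.
Qed.

End RelaxedToBV.

(** * A quadratic B-spline *)

Section Spline.
Context {R : realType}.
Notation mu := (@lebesgue_measure R).

Definition posp (x : R) : R := Num.max 0 x.

Lemma posp_ge x : 0 <= x -> posp x = x. Proof. by move=> ?; exact: max_r. Qed.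
Lemma posp_le x : x <= 0 -> posp x = 0. Proof. by move=> ?; exact: max_l. Qed.

Lemma continuous_posp : continuous posp.
Proof. by apply: continuous_maxr => x; [exact: cvg_cst|exact: cvg_id]. Qed.

(** A quadratic remainder valid for [h] of either sign treats the knots of truncated powers like all
    other points, without one-sided limits. *)
Lemma is_derive_quadratic (f : R -> R) (x l C : R) : 0 <= C ->
  (forall h : R, `|f (x + h) - f x - h * l| <= C * h ^+ 2) -> is_derive x 1 f l.
Proof.
move=> C0 hf.
have lim : (fun h : R => h^-1 *: ((f \o shift x) (h *: (1:R)) - f x)) @ 0^' --> l.
  apply/cvgrPdist_le => e e0.
  have d0 : 0 < e / (C + 1) by rewrite divr_gt0//; lra.
  near=> h.
  have h0 : h != 0 by near: h; exact: nbhs_dnbhs_neq.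
  have hd : `|h| < e / (C + 1).
    near: h; apply: dnbhs0_lt; exact: d0.
  rewrite /= /GRing.scale/= mulr1 [h + x]addrC.
  have -> : l - h^-1 * (f (x + h) - f x) = - h^-1 * (f (x + h) - f x - h * l).
    by field.
  rewrite normrM normrN normfV ler_pdivrMl ?normr_gt0//.
  apply: le_trans (hf h) _; rewrite -[h ^+ 2]real_normK ?num_real// expr2 mulrA.
  rewrite [leRHS]mulrC ler_wpM2r//.
  move: hd; rewrite ltr_pdivlMr; last lra.
  by move: (normr_ge0 h); nra.
split; first by apply/cvg_ex; exists l.
exact/cvg_lim.
Unshelve. all: by end_near.
Qed.

Lemma is_derive_posp2 (x : R) : is_derive x 1 (fun x => posp x ^+ 2) (2 * posp x).
Proof.
apply: (@is_derive_quadratic _ x (2 * posp x) 1) => // h; rewrite ler_norml.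
have [x0|x0] := leP 0 x; [rewrite (posp_ge x0)|rewrite (posp_le (ltW x0))];
  (have [y0|y0] := leP 0 (x + h); [rewrite (posp_ge y0)|rewrite (posp_le (ltW y0))]);
  apply/andP; split; nra.
Qed.

Lemma is_derive_posp3 (x : R) : is_derive x 1 (fun x => posp x ^+ 3) (3 * posp x ^+ 2).
Proof.
have pE y : y * posp y = posp y ^+ 2.
  by have [y0|y0] := leP 0 y; [rewrite (posp_ge y0) expr2|rewrite (posp_le (ltW y0)) mulr0 expr0n].
(* The product rule applied to x * (posp x)^2 reduces the cube to the square. *)
have -> : (fun x => posp x ^+ 3) = id * (fun x => posp x ^+ 2).
  apply/funext => y; rewrite /= exprS.
  by rewrite -[RHS]/(y * posp y ^+ 2) expr2 [RHS]mulrA pE expr2 mulrA.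
have h2 := is_derive_posp2 x.
apply: is_derive_eq; rewrite /= /GRing.scale/=.
by rewrite mulr1 mulrCA pE; ring.
Qed.

(** Quadratic B-spline with knots 1/8, 3/8, 5/8, 7/8, without normalisation: a nonnegative C^1 bump
    inside the unit cell. Truncated powers make its derivative and antiderivative explicit. Its mass
    is 1/32, the source of every 32 below, and the margin 1/8 keeps the test fields away from the
    boundary of the square. *)
Definition spline (x : R) : R :=
  posp (x - 1/8) ^+ 2 - 3 * posp (x - 3/8) ^+ 2 + 3 * posp (x - 5/8) ^+ 2 - posp (x - 7/8) ^+ 2.

Definition spline_int (x : R) : R :=
  3^-1 * (posp (x - 1/8) ^+ 3 - 3 * posp (x - 3/8) ^+ 3 + 3 * posp (x - 5/8) ^+ 3 - posp (x - 7/8) ^+ 3).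

Definition dspline (x : R) : R :=
  2 * posp (x - 1/8) - 3 * (2 * posp (x - 3/8)) + 3 * (2 * posp (x - 5/8)) - 2 * posp (x - 7/8).

Lemma is_derive_shift (f : R -> R) (x c d : R) : is_derive (x - c) 1 f d ->
  is_derive x 1 (fun x => f (x - c)) d.
Proof.
move=> df.
have dg : is_derive x 1 (fun x => x - c) 1.
  by apply: is_derive_eq; rewrite subr0.
have := @is_derive1_comp R f (fun x => x - c) x d 1 df dg.
by rewrite mulr1.
Qed.

Lemma is_derive_spline (x : R) : is_derive x 1 spline (dspline x).
Proof.
have h c := @is_derive_shift _ x c _ (is_derive_posp2 (x - c)).
have h1 := h (1/8); have h2 := h (3/8); have h3 := h (5/8); have h4 := h (7/8).
have := is_deriveB (is_deriveD (is_deriveB h1 (is_deriveZ 3 h2)) (is_deriveZ 3 h3)) h4.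
exact.
Qed.

Lemma is_derive_spline_int (x : R) : is_derive x 1 spline_int (spline x).
Proof.
have h c := @is_derive_shift _ x c _ (is_derive_posp3 (x - c)).
have h1 := h (1/8); have h2 := h (3/8); have h3 := h (5/8); have h4 := h (7/8).
have H := is_deriveB (is_deriveD (is_deriveB h1 (is_deriveZ 3 h2)) (is_deriveZ 3 h3)) h4.
have K := is_deriveZ (3^-1) H.
by apply: (is_derive_eq K); rewrite /GRing.scale/= /spline; field.
Qed.

Lemma continuous_spline : continuous spline.
Proof.
move=> x; apply: differentiable_continuous; apply/derivable1_diffP.
by have [] := is_derive_spline x.
Qed.

Lemma continuous_spline_int : continuous spline_int.
Proof.
move=> x; apply: differentiable_continuous; apply/derivable1_diffP.
by have [] := is_derive_spline_int x.
Qed.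

Lemma continuous_dspline : continuous dspline.
Proof.
have cc (r : R) : continuous (fun x : R => r) by move=> x; exact: cvg_cst.
have cp c : continuous (fun x => posp (x - c)).
  apply: continuous_comp1 continuous_posp.
  by move=> x; apply: cvgB; [exact: cvg_id|exact: cvg_cst].
apply: continuous_subr; last exact: continuous_mulr.
apply: continuous_addr; last by apply: continuous_mulr => //; exact: continuous_mulr.
by apply: continuous_subr; apply: continuous_mulr => //; exact: continuous_mulr.
Qed.

Lemma spline0 x : x <= 1/8 \/ 7/8 <= x -> spline x = 0.
Proof.
rewrite /spline; case=> h.
  by rewrite !posp_le; [ring|lra|lra|lra|lra].
by rewrite !posp_ge; [field|lra|lra|lra|lra].
Qed.

Lemma spline_itv x : 0 <= spline x <= 1.
Proof.
have [h|h] := leP x (1/8); first by rewrite spline0 ?lexx ?ler01//; left.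
have [h'|h'] := leP (7/8) x; first by rewrite spline0 ?lexx ?ler01//; right.
rewrite /spline (@posp_le (x - 7/8)) ?(@posp_ge (x - 1/8)); [|lra|lra].
have [a|a] := leP x (3/8).
  by rewrite !posp_le; [|lra|lra]; apply/andP; split; nra.
have [b|b] := leP x (5/8).
  by rewrite posp_ge ?posp_le; [|lra|lra]; apply/andP; split; nra.
rewrite !posp_ge; [|lra|lra].
have -> : (x - 1/8) ^+ 2 - 3 * (x - 3/8) ^+ 2 + 3 * (x - 5/8) ^+ 2 - 0 ^+ 2 = (7/8 - x) ^+ 2 by field.
by apply/andP; split; nra.
Qed.

Lemma spline_int0 x : x <= 1/8 -> spline_int x = 0.
Proof. by move=> h; rewrite /spline_int !posp_le; [ring|lra|lra|lra|lra]. Qed.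

Lemma spline_int1 x : 7/8 <= x -> spline_int x = 1/32.
Proof. by move=> h; rewrite /spline_int !posp_ge; [field|lra|lra|lra|lra]. Qed.

Lemma spline_int_homo x y : x <= y -> spline_int x <= spline_int y.
Proof.
move=> xy; rewrite -subr_ge0 -(Rintegral_FTC xy continuous_spline is_derive_spline_int).
by apply: Rintegral_ge0 => t _; have /andP[] := spline_itv t.
Qed.

Lemma spline_int_itv x : 0 <= spline_int x <= 1/32.
Proof.
apply/andP; split.
  have [h|h] := leP x (1/8); first by rewrite spline_int0.
  by rewrite -(@spline_int0 (1/8)) ?lexx// spline_int_homo// ltW.
have [h|h] := leP (7/8) x; first by rewrite spline_int1.
by rewrite -(@spline_int1 (7/8)) ?lexx// spline_int_homo// ltW.
Qed.

(** Integer translates of the bump have disjoint supports, so at most one term is nonzero. *)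
Lemma sum_spline_le1 (n : nat) (z : R) : \sum_(l < n) spline (z - l%:R) <= 1.
Proof.
elim: n => [|n IH]; first by rewrite big_ord0.
rewrite big_ord_recr/=; have [h|h] := leP (z - n%:R) (1/8).
  by rewrite [spline (z - _)]spline0 ?addr0//; left.
rewrite big1 ?add0r; first by have /andP[] := spline_itv (z - n%:R).
move=> l _; apply: spline0; right.
have : (l.+1%:R : R) <= n%:R by rewrite ler_nat.
by rewrite -natr1; lra.
Qed.

Lemma telescope_ord (f : nat -> R) (n : nat) :
  \sum_(j < n) (f j - f j.+1) = f 0%N - f n.
Proof.
by elim: n => [|n IH]; rewrite ?big_ord0 ?subrr// big_ord_recr/= IH; ring.
Qed.

(** A shift by [q] is split into [q] unit shifts. For each of them the sum over [k] telescopes to a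
    single difference of values in [0, 1/32], so the bound does not grow with [K]. *)
Lemma sum_spline_int_le (K q : nat) (z : R) :
  \sum_(k < K) (spline_int (z - k%:R) - spline_int (z - (k + q)%:R)) <= q%:R / 32.
Proof.
have E (k : nat) : spline_int (z - k%:R) - spline_int (z - (k + q)%:R) =
    \sum_(j < q) (spline_int (z - (k + j)%:R) - spline_int (z - (k + j.+1)%:R)).
  by rewrite (telescope_ord (fun j => spline_int (z - (k + j)%:R))) addn0.
under eq_bigr do rewrite E.
rewrite exchange_big/=.
have -> : q%:R / 32 = \sum_(j < q) (1/32) :> R.
  by rewrite sumr_const card_ord -[RHS]mulr_natl mul1r.
apply: ler_sum => j _.
under eq_bigr do rewrite addnS -addSn.
rewrite (telescope_ord (fun k => spline_int (z - (k + j)%:R))).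
have /andP[_ h1] := spline_int_itv (z - (0 + j)%:R).
have /andP[h2 _] := spline_int_itv (z - (K + j)%:R).
lra.
Qed.

End Spline.

(** * Bounded variation implies variation bounds on a grid *)

Section Tensor.
Context {R : realType}.
Implicit Types (p : R * R) (U : R * R -> R).
Notation mu := (@lebesgue_measure R).
Notation S := (@unit_square R)^°.

Lemma tensor_dx (I : Type) (s : seq I) (a : I -> R) (f f' g : I -> R -> R) :
  (forall i (x : R), is_derive x 1 (f i) (f' i x)) ->
  let G := fun p => \sum_(i <- s) a i * (f i p.1 * g i p.2) in
  (forall p, derivable G p (1, 0)) /\
  dx G = (fun p => \sum_(i <- s) a i * (f' i p.1 * g i p.2)).
Proof.
move=> df G.
have key (x y : R) : is_derive x 1 (fun t => G (t, y)) (\sum_(i <- s) a i * (f' i x * g i y)).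
  rewrite {}/G /=; elim: s => [|i s IH].
    rewrite big_nil; under eq_fun do rewrite big_nil.
    exact: is_derive_cst.
  have h := is_deriveD (is_deriveZ (a i * g i y) (df i x)) IH.
  rewrite big_cons.
  have -> : (fun t => \sum_(j <- i :: s) a j * (f j t * g j y)) =
      (fun t => a i * g i y * f i t + \sum_(j <- s) a j * (f j t * g j y)).
    by apply/funext => t; rewrite big_cons; congr (_ + _); ring.
  by apply: (is_derive_eq h); congr (_ + _); rewrite /GRing.scale/=; ring.
split; first by move=> [x y]; rewrite dx_line; have [] := key x y.
by apply/funext => -[x y]; rewrite dx_line; have [] := key x y.
Qed.

Lemma tensor_continuous (I : Type) (s : seq I) (a : I -> R) (f g : I -> R -> R) :
  (forall i, continuous (f i)) -> (forall i, continuous (g i)) ->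
  continuous (fun p => \sum_(i <- s) a i * (f i p.1 * g i p.2)).
Proof.
move=> cf cg; apply: continuous_sumr => i; apply: continuous_mulr.
  by move=> p; exact: cvg_cst.
apply: continuous_mulr; first exact: (continuous_comp1 continuous_fst1 (cf i)).
exact: (continuous_comp1 continuous_snd1 (cg i)).
Qed.

Lemma tensor_C1 (I : Type) (s : seq I) (a : I -> R) (f f' g g' : I -> R -> R) :
  (forall i (x : R), is_derive x 1 (f i) (f' i x)) ->
  (forall i (x : R), is_derive x 1 (g i) (g' i x)) ->
  (forall i, continuous (f i)) -> (forall i, continuous (f' i)) ->
  (forall i, continuous (g i)) -> (forall i, continuous (g' i)) ->
  is_C1 (fun p => \sum_(i <- s) a i * (f i p.1 * g i p.2)).
Proof.
move=> df dg cf cf' cg cg'.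
set G := (X in is_C1 X).
have [dG1 dG2] := tensor_dx s a g df.
have [dH1 dH2] := tensor_dx s a f dg.
have GE : (fun p => \sum_(i <- s) a i * (g i p.1 * f i p.2)) = G \o swap.
  by apply/funext => p; apply: eq_bigr => i _; rewrite [g i _ * _]mulrC.
rewrite GE in dH1 dH2.
split.
- exact: dG1.
- by move=> p; have := dH1 (swap p); rewrite derive_swap swapK.
- by rewrite dG2; exact: tensor_continuous.
have -> : dy G = dx (G \o swap) \o swap by apply/funext => p /=; rewrite derive_swap swapK.
rewrite dH2 => p; apply: continuous_comp; first exact: continuous_swap.
exact: tensor_continuous.
Qed.

(** The half of the total variation that involves the x-derivative, with compact support expressed
    by a margin [d]. The other half is the same statement for [U \o swap]. *)
Definition x_variation_le U (V : R) : Prop :=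
  forall (phi : R * R -> R) (d : R), is_C1 phi -> 0 < d ->
  (forall p, phi p != 0 -> d <= p.1 <= 1 - d /\ d <= p.2 <= 1 - d) ->
  (forall p, `|phi p| <= 1) -> sq_int (fun p => U p * dx phi p) <= V.

Lemma box_compactly_supported (phi : R * R -> R) (d : R) : 0 < d ->
  (forall p, phi p != 0 -> d <= p.1 <= 1 - d /\ d <= p.2 <= 1 - d) ->
  compactly_supported S phi.
Proof.
move=> d0 supp.
pose C : set (R * R) := `[d, 1 - d] `*` `[d, 1 - d].
have cC : compact C by apply: compact_setX; exact: segment_compact.
have clC : closed C by apply: compact_closed => //; exact: norm_hausdorff.
have sub : closure [set x | phi x != 0] `<=` C.
  move/closure_id : clC => ->; apply: closureS => -[x y] /supp[/= h1 h2].
  by split; rewrite /= in_itv.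
split; first by apply: subclosed_compact cC sub; exact: closed_closure.
apply: subset_trans sub _ => p [/=]; rewrite !in_itv/= interior_unit_square => h1 h2.
by split; rewrite /= in_itv/=; lra.
Qed.

Lemma is_C1_swap (phi : R * R -> R) : is_C1 phi -> is_C1 (phi \o swap).
Proof.
move=> [d1 d2 c1 c2].
have cs (h : R * R -> R) : continuous h -> continuous (h \o swap).
  by move=> ch p; apply: continuous_comp; [exact: continuous_swap|exact: ch].
split.
- by move=> p; rewrite derive_swap; exact: d2.
- by move=> p; have := derive_swap (phi \o swap) (swap p); rewrite swapK => -[<- _]; exact: d1.
- have -> : dx (phi \o swap) = dy phi \o swap by apply/funext => p; rewrite derive_swap.
  exact: cs.
- have -> : dy (phi \o swap) = dx phi \o swap by [].
  exact: cs.
Qed.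

Lemma is_C1_0 : is_C1 (fun=> 0 : R) /\ dx (fun=> 0 : R) = (fun=> 0) /\ dy (fun=> 0 : R) = fun=> 0.
Proof.
have z1 : dx (fun=> 0 : R) = (fun=> 0) by apply/funext => p; rewrite /dx derive_val.
have z2 : dy (fun=> 0 : R) = (fun=> 0) by apply/funext => p; rewrite /dy derive_val.
split=> //; split; rewrite ?z1 ?z2 => p; try exact: cvg_cst; exact: derivable_cst.
Qed.

(** The fields (phi, 0) and (0, phi \o swap) are admissible, so each half is bounded by the full
    variation. The zero field shows that the supremum is nonnegative, whence [fine] keeps its
    value. *)
Lemma BV_x_variation (u : R * R -> R) : {within unit_square, continuous u} -> BV S u ->
  exists V : R, [/\ 0 <= V, x_variation_le (ext u) V & x_variation_le (ext u \o swap) V].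
Proof.
move=> cu [_ vfin].
have cU := ext_continuous cu.
have [C0 [dx0 dy0]] := is_C1_0.
have sup0 : compactly_supported S (fun=> 0 : R).
  by apply: (@box_compactly_supported _ 1) => // p; rewrite eqxx.
have bound f g : test_field S (f, g) ->
    ((sq_int (fun p => ext u p * (dx f p + dy g p)))%:E <= variation2 S u)%E.
  move=> tf; apply: ereal_sup_ubound; exists (f, g) => //=.
  rewrite -sq_intE; last first.
    have [[[_ _ cf _] [_ _ _ cg]] _ _ _] := tf.
    by apply: continuous_mulr => //; exact: continuous_addr.
  by apply: eq_integral => p; rewrite inE => /sub_square Qp; rewrite ext_id.
have t0 : test_field S ((fun=> 0 : R), (fun=> 0 : R)).
  split => //= p; rewrite (le_trans (enorm_le _))//= normr0 addr0; exact: ler01.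
exists (fine (variation2 S u)).
have v0 : (0 <= variation2 S u)%E.
  apply: le_trans (bound _ _ t0); rewrite lee_fin dx0 dy0.
  have -> : (fun p => ext u p * (0 + 0)) = (fun p => 0 * ext u p).
    by apply/funext => p; rewrite addr0 mulr0 mul0r.
  by rewrite sq_intZ// mul0r.
have vE : (fine (variation2 S u))%:E = variation2 S u by rewrite fineK// ge0_fin_numE.
split; first exact: fine_ge0.
- move=> phi d C1 d0 supp phi1; rewrite -lee_fin vE.
  have -> : (fun p => ext u p * dx phi p) = (fun p => ext u p * (dx phi p + dy (fun=> 0 : R) p)).
    by apply/funext => p; rewrite dy0 addr0.
  apply: bound; split.
  + by split; [exact: C1|exact: C0].
  + exact: (box_compactly_supported d0 supp).
  + exact: sup0.
  by move=> p; apply: le_trans (enorm_le _) _; rewrite /= normr0 addr0.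
- move=> phi d C1 d0 supp phi1; rewrite -lee_fin vE.
  have [_ _ _ cd] := is_C1_swap C1.
  have E : (fun p => (ext u \o swap) p * dx phi p) =
      (fun p => ext u p * dy (phi \o swap) p) \o swap.
    by apply/funext => p /=; congr (_ * _); rewrite -[phi in LHS](_ : (phi \o swap) \o swap = phi) ?derive_swap//; apply/funext => q /=; rewrite swapK.
  rewrite E sq_int_swap; last exact: continuous_mulr.
  have -> : (fun p => ext u p * dy (phi \o swap) p) = (fun p => ext u p * (dx (fun=> 0 : R) p + dy (phi \o swap) p)).
    by apply/funext => p; rewrite dx0 add0r.
  apply: bound; split.
  + by split; [exact: C0|exact: is_C1_swap].
  + exact: sup0.
  + by apply: (box_compactly_supported d0) => p /supp[].
  + by move=> p; apply: le_trans (enorm_le _) _; rewrite /= normr0 add0r; exact: phi1.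
Qed.

End Tensor.

(** * Increments between the centres of the small cells *)

Section Grid.
Context {R : realType}.
Implicit Types (p : R * R) (U : R * R -> R).
Notation mu := (@lebesgue_measure R).

Lemma is_derive_affine (f f' : R -> R) (m c x : R) : (forall x : R, is_derive x 1 f (f' x)) ->
  is_derive x 1 (fun x => f (m * x - c)) (m * f' (m * x - c)).
Proof.
move=> df.
have dg : is_derive x 1 (fun x => m * x - c) m.
  have h := is_deriveB (is_deriveZ m (@is_derive_id R R x 1)) (is_derive_cst c x 1).
  by apply: (is_derive_eq h); rewrite /GRing.scale/= mulr1 subr0.
have h := @is_derive1_comp R f (fun x => m * x - c) x _ m (df _) dg.
by apply: (is_derive_eq h); rewrite mulrC.
Qed.

Lemma continuous_affine (f : R -> R) (m c : R) : continuous f ->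
  continuous (fun x => f (m * x - c)).
Proof.
move=> cf; apply: continuous_comp1 cf.
apply: continuous_subr; last by move=> x; exact: cvg_cst.
by apply: continuous_mulr => x; [exact: cvg_cst|exact: cvg_id].
Qed.

Definition cellspline (m k : nat) (x : R) : R := spline (m%:R * x - k%:R).

Lemma integral_cellspline (m k : nat) : (k < m)%N ->
  \int[mu]_(x in `[0, 1]) cellspline m k x = (32 * m%:R)^-1.
Proof.
move=> km; have m0 : 0 < m%:R :> R by rewrite ltr0n; exact: leq_ltn_trans km.
have dB (x : R) : is_derive x 1 (fun x => m%:R^-1 * spline_int (m%:R * x - k%:R)) (cellspline m k x).
  have h := is_deriveZ (m%:R^-1) (is_derive_affine m%:R k%:R x (@is_derive_spline_int R)).
  by apply: (is_derive_eq h); rewrite /GRing.scale/= mulrA mulVf ?mul1r// gt_eqF.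
rewrite (@Rintegral_FTC _ _ _ 0 1 ler01 _ dB); last exact/continuous_affine/continuous_spline.
have h : (k.+1%:R : R) <= m%:R by rewrite ler_nat.
rewrite -natr1 in h; have k0 : (0:R) <= k%:R by [].
rewrite mulr1 mulr0 sub0r spline_int1; last lra.
by rewrite spline_int0; [field; rewrite gt_eqF|lra].
Qed.

Definition cmid (m k : nat) : R := (k%:R + 1/2) / m%:R.

Lemma cellspline_near (m k : nat) (x : R) : (0 < m)%N -> cellspline m k x != 0 -> `|cmid m k - x| < m%:R^-1.
Proof.
move=> m0; have mR : 0 < m%:R :> R by rewrite ltr0n.
move=> h; have [h1 h2] : 1/8 < m%:R * x - k%:R /\ m%:R * x - k%:R < 7/8.
  by split; rewrite ltNge; apply: contraNN h => h; apply/eqP/spline0; [left|right].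
have -> : cmid m k - x = (k%:R + 1/2 - m%:R * x) / m%:R.
  by rewrite /cmid mulrBl [m%:R * x]mulrC mulfK// gt_eqF.
rewrite normrM [`|_^-1|]gtr0_norm ?invr_gt0// -[ltRHS]mul1r ltr_pM2r ?invr_gt0//.
by rewrite ltr_norml; lra.
Qed.

Lemma cmid_itv (m k : nat) : (k < m)%N -> 0 <= cmid m k <= 1.
Proof.
move=> km; have m0 : 0 < m%:R :> R by rewrite ltr0n; exact: leq_ltn_trans km.
have h : (k.+1%:R : R) <= m%:R by rewrite ler_nat.
rewrite -natr1 in h; have k0 : (0:R) <= k%:R by [].
by rewrite /cmid divr_ge0 ?ler_pdivrMr//; lra.
Qed.

Lemma continuous_cellspline m k : continuous (cellspline m k).
Proof. exact/continuous_affine/continuous_spline. Qed.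

Lemma cellspline_itv m k x : 0 <= cellspline m k x <= 1.
Proof. exact: spline_itv. Qed.

Lemma continuous_cellspline2 (m k l : nat) : continuous (fun p => cellspline m k p.1 * cellspline m l p.2).
Proof.
apply: continuous_mulr.
  exact: (continuous_comp1 continuous_fst1 (@continuous_cellspline m k)).
exact: (continuous_comp1 continuous_snd1 (@continuous_cellspline m l)).
Qed.

(** The product bump is a nonnegative weight of mass (32m)^-2, and wherever it is nonzero [U] is
    within [e] of its value at the centre of the cell. *)
Lemma cell_integral U (m k l : nat) (e : R) : continuous U -> (k < m)%N -> (l < m)%N ->
  (forall p q, unit_square p -> `|p.1 - q.1| < m%:R^-1 -> `|p.2 - q.2| < m%:R^-1 ->
     `|U p - U q| < e) ->
  `|sq_int (fun p => U p * (cellspline m k p.1 * cellspline m l p.2)) -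
    U (cmid m k, cmid m l) * (32 * m%:R)^-1 ^+ 2| <= e * (32 * m%:R)^-1 ^+ 2.
Proof.
move=> cU km lm osc.
have m0 : (0 < m)%N by exact: leq_ltn_trans km.
pose b p := cellspline m k p.1 * cellspline m l p.2.
pose c := U (cmid m k, cmid m l).
have cb : continuous b by exact: continuous_cellspline2.
have ib : sq_int b = (32 * m%:R)^-1 ^+ 2.
  by rewrite (sq_int_prod (@continuous_cellspline m k) (@continuous_cellspline m l)) !integral_cellspline// expr2.
have b0 p : 0 <= b p.
  by rewrite mulr_ge0//; [case/andP: (cellspline_itv m k p.1)|case/andP: (cellspline_itv m l p.2)].
have cc (r : R) : continuous (fun p => r * b p).
  by apply: continuous_mulr => // p; exact: cvg_cst.
have near p : `|U p * b p - c * b p| <= e * b p.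
  have [->|bp] := eqVneq (b p) 0; first by rewrite !mulr0 subr0 normr0.
  rewrite -mulrBl normrM [`|b p|]ger0_norm// ler_wpM2r// distrC ltW//.
  move: bp; rewrite /b mulf_eq0 negb_or => /andP[h1 h2].
  by apply: osc; [apply/unit_squareP; split; exact: cmid_itv|exact: cellspline_near|exact: cellspline_near].
rewrite -/c -ib -!sq_intZ//.
have cUb : continuous (fun p => U p * b p) by exact: continuous_mulr.
change (`|sq_int (fun p => U p * b p) - sq_int (fun p => c * b p)| <= sq_int (fun p => e * b p)).
rewrite ler_norml; apply/andP; split.
  rewrite lerBrDr -[- _]mulN1r -sq_intZ// -sq_intD//; last first.
    by apply: continuous_mulr => // p; exact: cvg_cst.
  apply: le_sq_int => //.
    by apply: continuous_addr => //; apply: continuous_mulr => // p; exact: cvg_cst.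
  by move=> p _; have := near p; rewrite ler_norml => /andP[]; lra.
rewrite lerBlDr -sq_intD//; apply: le_sq_int => //; first exact: continuous_addr.
by move=> p _; have := near p; rewrite ler_norml => /andP[]; lra.
Qed.

(** With N = n+1 and M = Nq, the plateaus [f i] sum to at most q/(32M) over [k] and the bumps [g i]
    to at most 1 over [l], so the factor 32N gives |G| <= 1. Testing [U] against [dx G] recovers
    each |w i| with weight 32NK, where K = (32M)^-2, up to an error 2/N per pair. Hence the sum of
    the |w i| is at most V/(32NK) + 2nqM/N, where the first term is 32VNq^2 and the second is at
    most 2Nq^2. *)
Lemma x_variation_grid U (V : R) (n q : nat) : continuous U -> x_variation_le U V ->
  (0 < q)%N ->
  (forall p p', unit_square p -> `|p.1 - p'.1| < (n.+1 * q)%:R^-1 ->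
     `|p.2 - p'.2| < (n.+1 * q)%:R^-1 -> `|U p - U p'| < n.+1%:R^-1) ->
  \sum_(k < n * q) \sum_(l < n.+1 * q)
    `|U (cmid (n.+1 * q) (k + q), cmid (n.+1 * q) l) - U (cmid (n.+1 * q) k, cmid (n.+1 * q) l)|
  <= (32 * V + 2) * n.+1%:R * q%:R ^+ 2.
Proof.
move=> cU UV q0 osc; set m := (n.+1 * q)%N in osc *.
pose N : R := n.+1%:R; pose Q : R := q%:R; pose M : R := m%:R.
have N0 : 0 < N by rewrite ltr0n.
have Q0 : 0 < Q by rewrite ltr0n.
have ME : M = N * Q by rewrite /M /m natrM.
have M0 : 0 < M by rewrite ME mulr_gt0.
have m0 : (0 < m)%N by rewrite /m muln_gt0.
pose I := ('I_(n * q) * 'I_m)%type.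
have kq (i : I) : (i.1 + q < m)%N.
  have h : (i.1 + q < n * q + q)%N by rewrite ltn_add2r; exact: ltn_ord.
  by apply: leq_trans h (eq_leq _); rewrite /m mulSn addnC.
have km (i : I) : (i.1 < m)%N by apply: leq_ltn_trans (kq i); exact: leq_addr.
have lm (i : I) : (i.2 < m)%N by exact: ltn_ord.
pose w (i : I) : R := U (cmid m (i.1 + q), cmid m i.2) - U (cmid m i.1, cmid m i.2).
(* The sign is reversed because [f' i] is the left bump minus the right one, while [w i] is the
   right value minus the left one. *)
pose a (i : I) : R := 32 * N * - Num.sg (w i).
pose f (i : I) (x : R) : R :=
  M^-1 * spline_int (M * x - i.1%:R) - M^-1 * spline_int (M * x - (i.1 + q)%:R).
pose f' (i : I) (x : R) : R := cellspline m i.1 x - cellspline m (i.1 + q) x.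
pose g (i : I) (x : R) : R := cellspline m i.2 x.
pose g' (i : I) (x : R) : R := M * dspline (M * x - i.2%:R).
have df i (x : R) : is_derive x 1 (f i) (f' i x).
  have h c := is_deriveZ (M^-1) (is_derive_affine M c x (@is_derive_spline_int R)).
  apply: (is_derive_eq (is_deriveB (h i.1%:R) (h (i.1 + q)%:R))).
  by rewrite /GRing.scale/= !mulrA mulVf ?mul1r// gt_eqF.
have dg i (x : R) : is_derive x 1 (g i) (g' i x).
  exact: is_derive_affine (@is_derive_spline R).
have cf i : continuous (f i).
  have h c : continuous (fun x => M^-1 * spline_int (M * x - c)).
    apply: continuous_mulr; first by move=> x; exact: cvg_cst.
    exact/continuous_affine/continuous_spline_int.
  exact: continuous_subr.
have cf' i : continuous (f' i) by apply: continuous_subr; exact: continuous_cellspline.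
have cg i : continuous (g i) by exact: continuous_cellspline.
have cg' i : continuous (g' i).
  apply: continuous_mulr; first by move=> x; exact: cvg_cst.
  exact/continuous_affine/continuous_dspline.
pose G p := \sum_(i <- enum {: I}) a i * (f i p.1 * g i p.2).
have C1G : is_C1 G := tensor_C1 (enum {: I}) a df dg cf cf' cg cg'.
have [_ dxG] := tensor_dx (enum {: I}) a g df.
have f0 i x : 0 <= f i x.
  rewrite /f subr_ge0 ler_pM2l ?invr_gt0// spline_int_homo// natrD.
  have : 0 <= (q%:R : R) by [].
  lra.
have g0 i x : 0 <= g i x by case/andP: (cellspline_itv m i.2 x).
have aN i : `|a i| <= 32 * N.
  rewrite /a normrM normrN [`|32 * N|]gtr0_norm ?mulr_gt0// ler_piMr//; first by rewrite mulr_ge0// ltW.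
  by rewrite normr_sg; case: (_ != 0).
have G1 p : `|G p| <= 1.
  apply: (@le_trans _ _ (\sum_(i <- enum {: I}) 32 * N * (f i p.1 * g i p.2))).
    apply: le_trans (ler_norm_sum _ _ _) _; apply: ler_sum => i _.
    by rewrite normrM [`|f i _ * _|]ger0_norm ?mulr_ge0// ler_wpM2r// mulr_ge0.
  rewrite -mulr_sumr big_enum/=.
  rewrite -(pair_bigA _ (fun (k : 'I_(n * q)) (l : 'I_m) => f (k, l) p.1 * g (k, l) p.2))/=.
  have -> : \sum_(k < n * q) \sum_(l < m) f (k, l) p.1 * g (k, l) p.2 =
     M^-1 * (\sum_(k < n * q) (spline_int (M * p.1 - k%:R) - spline_int (M * p.1 - (k + q)%:R))) *
     \sum_(l < m) spline (M * p.2 - l%:R).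
    rewrite [M^-1 * _]mulr_sumr big_distrlr/=; apply: eq_bigr => k _; apply: eq_bigr => l _.
    by congr (_ * _); rewrite [RHS]mulrBr.
  have h1 := sum_spline_int_le (n * q) q (M * p.1).
  have h2 := sum_spline_le1 m (M * p.2).
  have h1' : 0 <= \sum_(k < n * q) (spline_int (M * p.1 - k%:R) - spline_int (M * p.1 - (k + q)%:R)).
    apply: sumr_ge0 => k _; rewrite subr_ge0 spline_int_homo// natrD.
    have : 0 <= (q%:R : R) by [].
    lra.
  have h2' : 0 <= \sum_(l < m) spline (M * p.2 - l%:R).
    by apply: sumr_ge0 => l _; case/andP: (spline_itv (M * p.2 - l%:R)).
  have E1 : 32 * N * (M^-1 * (q%:R / 32) * 1) = 1.
    by rewrite ME -/Q; field; rewrite !gt_eqF.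
  rewrite -[leRHS]E1.
  rewrite ler_pM2l ?mulr_gt0//; apply: ler_pM => //.
    by rewrite mulr_ge0// invr_ge0 ltW.
  by rewrite ler_pM2l ?invr_gt0.
have supp p : G p != 0 -> (8 * M)^-1 <= p.1 <= 1 - (8 * M)^-1 /\
    (8 * M)^-1 <= p.2 <= 1 - (8 * M)^-1.
  move=> Gp.
  have [i [fi gi]] : exists i, f i p.1 != 0 /\ g i p.2 != 0.
    apply: contrapT => no; move: Gp; rewrite /G big1_seq ?eqxx// => i _.
    have [->|fi] := eqVneq (f i p.1) 0; first by rewrite mul0r mulr0.
    have [->|gi] := eqVneq (g i p.2) 0; first by rewrite !mulr0.
    by case: no; exists i.
  have E8 : (8 * M)^-1 = (1/8) / M by field; rewrite gt_eqF.
  have box (z k : R) : 0 <= k -> k + 1 <= M -> 1/8 <= M * z -> M * z <= k + 7/8 ->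
      (8 * M)^-1 <= z <= 1 - (8 * M)^-1.
    move=> k0 k1 h1 h2; rewrite E8.
    have -> : 1 - 1/8/M = (M - 1/8) / M by field; rewrite gt_eqF.
    by rewrite ler_pdivrMr// ler_pdivlMr// [z * M]mulrC; lra.
  split.
    apply: (box _ (i.1 + q)%:R) => //.
    - by have : ((i.1 + q).+1%:R : R) <= M by [rewrite ler_nat; exact: kq]; rewrite -natr1.
    - rewrite leNgt; apply: contraNN fi => h; rewrite /f !spline_int0 ?subrr//.
      + have : 0 <= ((i.1 + q)%:R : R) by [].
        by lra.
      + have : 0 <= (i.1%:R : R) by [].
        by lra.
    (* To the right of both bumps the two antiderivatives have the same value 1/32 and cancel. *)
    - rewrite leNgt; apply: contraNN fi => h; rewrite /f !spline_int1 ?subrr//; first lra.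
      have : (0 : R) <= q%:R by [].
      by move: h; rewrite natrD; lra.
  apply: (box _ i.2%:R) => //.
  - by have : (i.2.+1%:R : R) <= M by [rewrite ler_nat; exact: lm]; rewrite -natr1.
  - rewrite leNgt; apply: contraNN gi => h; apply/eqP/spline0; left.
    have : 0 <= (i.2%:R : R) by [].
    by rewrite -/M; lra.
  - by rewrite leNgt; apply: contraNN gi => h; apply/eqP/spline0; right; rewrite -/M; lra.
have M8 : 0 < (8 * M)^-1 by rewrite invr_gt0 mulr_gt0.
have bound := UV G _ C1G M8 supp G1.
pose J (k l : nat) := sq_int (fun p => U p * (cellspline m k p.1 * cellspline m l p.2)).
have E : sq_int (fun p => U p * dx G p) =
    \sum_(i <- enum {: I}) a i * (J i.1 i.2 - J (i.1 + q)%N i.2).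
  have cJ k l : continuous (fun p => U p * (cellspline m k p.1 * cellspline m l p.2)).
    by apply: continuous_mulr => //; exact: continuous_cellspline2.
  transitivity (\sum_(i <- enum {: I}) sq_int (fun p => a i *
      (U p * (cellspline m i.1 p.1 * cellspline m i.2 p.2) -
       U p * (cellspline m (i.1 + q) p.1 * cellspline m i.2 p.2)))); last first.
    by apply: eq_bigr => i _; rewrite sq_intZ ?sq_intB//; exact: continuous_subr.
  rewrite -sq_int_sum; last first.
    move=> i; apply: continuous_mulr; first by move=> p; exact: cvg_cst.
    exact: continuous_subr.
  congr sq_int; apply/funext => p; rewrite dxG mulr_sumr; apply: eq_bigr => i _.
  by rewrite /f' /g; ring.
pose K : R := (32 * M)^-1 ^+ 2.
have K0 : 0 < K by rewrite exprn_gt0// invr_gt0 mulr_gt0.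
have low i : 32 * N * K * (`|w i| - 2 * N^-1) <= a i * (J i.1 i.2 - J (i.1 + q)%N i.2).
  have j1 : `|J i.1 i.2 - U (cmid m i.1, cmid m i.2) * K| <= N^-1 * K.
    exact: cell_integral cU (km i) (lm i) osc.
  have j2 : `|J (i.1 + q)%N i.2 - U (cmid m (i.1 + q), cmid m i.2) * K| <= N^-1 * K.
    exact: cell_integral cU (kq i) (lm i) osc.
  have -> : 32 * N * K * (`|w i| - 2 * N^-1) = 32 * N * (K * (`|w i| - 2 * N^-1)) by ring.
  rewrite /a -[leRHS]mulrA ler_pM2l ?mulr_gt0//.
  move: j1 j2; rewrite /w.
  set x := U (cmid m (i.1 + q), _); set y := U (cmid m i.1, _); rewrite !ler_norml => /andP[a1 a2] /andP[b1 b2].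
  have -> : `|x - y| = Num.sg (x - y) * (x - y) by rewrite -normrEsg.
  have e0 : x - y = 0 -> x = y by lra.
  move: (N^-1) (J i.1 i.2) (J (i.1 + q)%N i.2) a1 a2 b1 b2 => r j1 j2 a1 a2 b1 b2.
  have [/e0 e|e|e] := sgrP (x - y); rewrite ?mul0r ?mul1r ?mulN1r ?oppr0 ?mul0r ?opprK.
  - by lra.
  - by lra.
  - by lra.
rewrite pair_bigA /=.
have -> : \sum_(i : I) `|U (cmid m (i.1 + q), cmid m i.2) - U (cmid m i.1, cmid m i.2)| =
    \sum_(i <- enum {: I}) `|w i| by rewrite big_enum.
have : \sum_(i <- enum {: I}) 32 * N * K * (`|w i| - 2 * N^-1) <= V.
  by apply: le_trans bound; rewrite E; apply: ler_sum => i _; exact: low.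
rewrite -mulr_sumr sumrB.
have -> : \sum_(i <- enum {: I}) 2 * N^-1 = (n * q)%:R * M * (2 * N^-1).
  by rewrite big_enum/= sumr_const card_prod !card_ord -[LHS]mulr_natl natrM.
move: (\sum_(i <- _) _) => W.
have p0 : 0 < 32 * N * K by rewrite pmulr_lgt0// mulr_gt0.
rewrite mulrC -ler_pdivlMr// => h.
have -> : (32 * V + 2) * n.+1%:R * q%:R ^+ 2 = V / (32 * N * K) + N * Q * M * (2 * N^-1).
  rewrite /K ME /N /Q; field.
  by rewrite -/N -/Q !gt_eqF.
rewrite lerBlDr in h; apply: le_trans h _; rewrite lerD2l.
rewrite ler_pM2r ?mulr_gt0 ?invr_gt0// ler_pM2r// natrM ler_pM2r//.
by rewrite ler_nat.
Qed.

End Grid.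

(** * Averaging over the translates of the coarse grid *)

Section Offset.
Context {R : realType}.
Implicit Types (U : R * R -> R).

Lemma sum_ord_mul (F : nat -> R) (n q : nat) :
  \sum_(k < n * q) F k = \sum_(i < n) \sum_(a < q) F (i * q + a)%N.
Proof.
elim: n => [|n IH]; first by rewrite mul0n !big_ord0.
rewrite mulSn addnC big_split_ord /= IH big_ord_recr /=.
by congr (_ + _); apply: eq_bigr => a _.
Qed.

Lemma sum_le_exists (q : nat) (S : 'I_q -> 'I_q -> R) (c : R) : (0 < q)%N ->
  \sum_(a < q) \sum_(b < q) S a b <= c * q%:R ^+ 2 -> exists a b, S a b <= c.
Proof.
move=> q0 h; apply: contrapT => no.
have {}no a b : c < S a b by rewrite ltNge; apply/negP => ?; apply: no; exists a, b.
move: h; apply/negP; rewrite -ltNge.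
have -> : c * q%:R ^+ 2 = \sum_(a < q) \sum_(b < q) c.
  by rewrite !sumr_const !card_ord -mulrnA -[RHS]mulr_natr natrM expr2.
have o : 'I_q by exact: Ordinal q0.
have ne : has predT (index_enum 'I_q) by apply/hasP; exists o => //; exact: mem_index_enum.
by apply: ltr_sum => // a _; apply: ltr_sum.
Qed.

Definition shifted_grid (n : nat) (s : R) (i : nat) : R := i%:R / n.+1%:R + s.

Definition grid_variation U (n : nat) (s s' : R) : R :=
  \sum_(i < n) \sum_(j < n.+1)
    `|U (shifted_grid n s i.+1, shifted_grid n s' j) - U (shifted_grid n s i, shifted_grid n s' j)| +
  \sum_(j < n) \sum_(i < n.+1)
    `|U (shifted_grid n s i, shifted_grid n s' j.+1) - U (shifted_grid n s i, shifted_grid n s' j)|.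

(** Residues of the two indices modulo [q] split the centres of the small cells into q^2 translates
    of the coarse grid, so some translate carries at most the average of the fine sums. Centres of
    small cells have offsets strictly between 0 and 1/(n+1), which keeps the boundary strips
    nondegenerate. *)
Lemma grid_offset U (V : R) (n : nat) : continuous U ->
  x_variation_le U V -> x_variation_le (U \o swap) V ->
  exists s s' : R, [/\ 0 < s < n.+1%:R^-1, 0 < s' < n.+1%:R^-1 &
    grid_variation U n s s' <= 2 * (32 * V + 2) * n.+1%:R].
Proof.
move=> cU UV UV'.
have N0 : 0 < n.+1%:R^-1 :> R by rewrite invr_gt0.
have [d d0 osc] := continuous_unif cU N0.
have [k] := ltr_add_invr d0; rewrite add0r; set q := k.+1 => qd.
have md : (n.+1 * q)%:R^-1 < d.
  apply: le_lt_trans qd; rewrite lef_pV2 ?posrE ?ltr0n ?muln_gt0// ler_nat.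
  by rewrite leq_pmull.
have oscm p p' : unit_square p -> `|p.1 - p'.1| < (n.+1 * q)%:R^-1 ->
     `|p.2 - p'.2| < (n.+1 * q)%:R^-1 -> `|U p - U p'| < n.+1%:R^-1.
  by move=> Qp h1 h2; apply: osc => //; exact: lt_trans md.
have oscm' p p' : unit_square p -> `|p.1 - p'.1| < (n.+1 * q)%:R^-1 ->
     `|p.2 - p'.2| < (n.+1 * q)%:R^-1 -> `|(U \o swap) p - (U \o swap) p'| < n.+1%:R^-1.
  move=> /unit_squareP[Qp1 Qp2] h1 h2; apply: (oscm (swap p) (swap p') _ h2 h1).
  by apply/unit_squareP; split.
have cU' : continuous (U \o swap).
  by move=> p; apply: continuous_comp; [exact: continuous_swap|exact: cU].
pose F1 (k l : nat) := `|U (cmid (n.+1 * q) (k + q), cmid (n.+1 * q) l) -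
  U (cmid (n.+1 * q) k, cmid (n.+1 * q) l)|.
pose F2 (k l : nat) := `|U (cmid (n.+1 * q) l, cmid (n.+1 * q) (k + q)) -
  U (cmid (n.+1 * q) l, cmid (n.+1 * q) k)|.
have g1 : \sum_(k < n * q) \sum_(l < n.+1 * q) F1 k l <= (32 * V + 2) * n.+1%:R * q%:R ^+ 2.
  exact: x_variation_grid cU UV (ltn0Sn k) oscm.
have g2 : \sum_(k < n * q) \sum_(l < n.+1 * q) F2 k l <= (32 * V + 2) * n.+1%:R * q%:R ^+ 2.
  exact: x_variation_grid cU' UV' (ltn0Sn k) oscm'.
pose s (a : 'I_q) : R := (a%:R + 1/2) / (n.+1 * q)%:R.
have sE (i : nat) (a : 'I_q) : cmid (n.+1 * q) (i * q + a) = shifted_grid n (s a) i.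
  have N1 : (n.+1%:R : R) != 0 by rewrite pnatr_eq0.
  have q1 : (q%:R : R) != 0 by rewrite pnatr_eq0.
  rewrite /cmid /shifted_grid /s natrD !natrM.
  by move: N1 q1; move: (n.+1%:R) (q%:R) => x y x0 y0; field; rewrite x0 y0.
have sE' (i : nat) (a : 'I_q) : cmid (n.+1 * q) (i * q + a + q) = shifted_grid n (s a) i.+1.
  by rewrite -sE; congr cmid; lia.
have reg (F : nat -> nat -> R) : \sum_(k < n * q) \sum_(l < n.+1 * q) F k l =
    \sum_(a < q) \sum_(b < q) \sum_(i < n) \sum_(j < n.+1) F (i * q + a)%N (j * q + b)%N.
  rewrite (sum_ord_mul (fun k => \sum_(l < n.+1 * q) F k l)) exchange_big/=.
  apply: eq_bigr => a _; rewrite [RHS]exchange_big/=; apply: eq_bigr => i _.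
  rewrite (sum_ord_mul (F (i * q + a)%N)) exchange_big/=.
  by apply: eq_bigr => j _; apply: eq_bigr => b _.
rewrite !reg in g1 g2.
have [a [b hab]] : exists a b, grid_variation U n (s a) (s b) <= 2 * (32 * V + 2) * n.+1%:R.
  apply: sum_le_exists => //.
  have -> : 2 * (32 * V + 2) * n.+1%:R * q%:R ^+ 2 =
     (32 * V + 2) * n.+1%:R * q%:R ^+ 2 + (32 * V + 2) * n.+1%:R * q%:R ^+ 2 by ring.
  apply: le_trans (lerD g1 g2); rewrite le_eqVlt; apply/orP; left; apply/eqP.
  under eq_bigr do rewrite big_split/=.
  rewrite big_split/=; congr (_ + _).
    apply: eq_bigr => a _; apply: eq_bigr => b _; apply: eq_bigr => i _; apply: eq_bigr => j _.
    by rewrite /F1 sE' !sE.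
  (* In [F2] the first index runs vertically, so the outer residue is the vertical offset. *)
  rewrite [RHS]exchange_big/=.
  apply: eq_bigr => a _; apply: eq_bigr => b _; apply: eq_bigr => i _; apply: eq_bigr => j _.
  by rewrite /F2 sE' !sE.
have s01 (c : 'I_q) : 0 < s c < n.+1%:R^-1.
  have q0 : 0 < q%:R :> R by rewrite ltr0n.
  have NR : 0 < n.+1%:R :> R by [].
  rewrite /s natrM; apply/andP; split.
    by apply: divr_gt0; [rewrite ltr_wpDl|rewrite mulr_gt0].
  rewrite invfM mulrCA -[ltRHS]mulr1 ltr_pM2l ?invr_gt0// ltr_pdivrMr// mul1r.
  have : (c.+1%:R : R) <= q%:R by rewrite ler_nat.
  by rewrite -natr1; lra.
by exists (s a), (s b).
Qed.

End Offset.

(** * The diagonal triangulation of a grid *)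

Section Partition.
Context {R : realType}.
Implicit Types (p q : R * R) (s t : seq (R * R)).

(** Weights attached to points rather than to positions can be compared between different lists of
    vertices; [uniq] makes the two descriptions interchangeable. *)
Lemma hull_weightsP s p : uniq s -> convex_hull s p <->
  exists W : R * R -> R, [/\ forall q, 0 <= W q, \sum_(q <- s) W q = 1
                           & p = \sum_(q <- s) W q *: q].
Proof.
move=> us; split=> [[w [w0 w1 ->]]|[W [W0 W1 ->]]]; last first.
  exists (fun i => W s`_i); split => //; first by rewrite (big_nth 0) big_mkord in W1.
  by rewrite (big_nth 0) big_mkord.
exists (fun q => \sum_(i < size s | s`_i == q) w i).
have E (i : 'I_(size s)) : \sum_(j < size s | s`_j == s`_i) w j = w i.
  rewrite (big_pred1 i)// => j /=; apply/eqP/eqP => [h|->//].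
  by apply/val_inj/eqP; rewrite -(nth_uniq 0 (ltn_ord j) (ltn_ord i) us) h.
split.
- by move=> q; apply: sumr_ge0.
- by rewrite (big_nth 0) big_mkord -[RHS]w1; apply: eq_bigr.
- by rewrite (big_nth 0) big_mkord; apply: eq_bigr => i _; rewrite E.
Qed.

Lemma big_uniq_sub (V : nmodType) s t (F : R * R -> V) : uniq s -> uniq t -> {subset s <= t} ->
  (forall q, q \in t -> q \notin s -> F q = 0) -> \sum_(q <- t) F q = \sum_(q <- s) F q.
Proof.
move=> us ut st F0; rewrite (bigID (mem s))/= [X in _ + X]big1_seq ?addr0; last first.
  by move=> q /andP[qs qt]; exact: F0.
rewrite -big_filter; apply: perm_big; apply: uniq_perm => //; first exact: filter_uniq.
by move=> q; rewrite mem_filter; case qs: (q \in s) => //=; rewrite st.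
Qed.

Lemma hull_mono s t : uniq s -> uniq t -> {subset s <= t} -> convex_hull s `<=` convex_hull t.
Proof.
move=> us ut st p /(hull_weightsP _ us)[W [W0 W1 ->]]; apply/(hull_weightsP _ ut).
exists (fun q => if q \in s then W q else 0); split.
- by move=> q; case: ifP.
- rewrite (big_uniq_sub us ut st); last by move=> q _ /negbTE ->.
  by rewrite -[RHS]W1; apply: eq_big_seq => q ->.
- rewrite (big_uniq_sub us ut st); last by move=> q _ /negbTE ->; rewrite scale0r.
  by apply: eq_big_seq => q ->.
Qed.

(** For increasing nodes, the continuous piecewise affine map that takes [x i] to [i]: each clamped
    ramp counts one cell. It reduces a grid of unequal steps to the integer grid. *)
Definition pl_coord (L : nat) (x : nat -> R) (t : R) : R :=
  \sum_(i < L) clamp01 ((t - x i) / (x i.+1 - x i)).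

Definition increasing_upto (L : nat) (x : nat -> R) : Prop :=
  forall i, (i < L)%N -> x i < x i.+1.

Lemma increasing_upto_le L x i j : increasing_upto L x -> (i <= j)%N -> (j <= L)%N -> x i <= x j.
Proof.
move=> inc; elim: j => [|j IH]; first by rewrite leqn0 => /eqP ->.
rewrite leq_eqVlt => /predU1P[->//|ij] jL.
by apply: le_trans (IH ij (ltnW jL)) (ltW (inc j jL)).
Qed.

Lemma clamp01_ge1 (z : R) : 1 <= z -> clamp01 z = 1.
Proof. by move=> h; rewrite /clamp01 (min_r h) max_r. Qed.

Lemma clamp01_le0 (z : R) : z <= 0 -> clamp01 z = 0.
Proof. by move=> h; rewrite /clamp01 min_l ?max_l//; lra. Qed.

Lemma pl_coord_cell L x (k : nat) (a : R) : increasing_upto L x -> (k < L)%N -> 0 <= a <= 1 ->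
  pl_coord L x (x k + a * (x k.+1 - x k)) = k%:R + a.
Proof.
move=> inc kL a01; rewrite /pl_coord.
have dk : 0 < x k.+1 - x k by rewrite subr_gt0; exact: inc.
set t := x k + _.
have tk : x k <= t <= x k.+1 by rewrite /t; apply/andP; split; nra.
(* At [t] the ramps of the cells before the k-th are saturated at 1 and those after it are still
   0. *)
have key l : (l <= L)%N -> \sum_(i < l) clamp01 ((t - x i) / (x i.+1 - x i)) =
    (minn l k)%:R + (if (k < l)%N then a else 0).
  elim: l => [|l IH] lL; first by rewrite big_ord0 min0n add0r.
  rewrite big_ord_recr/= IH ?(ltnW lL)//.
  have dl : 0 < x l.+1 - x l by rewrite subr_gt0; exact: inc.
  have [lk|] := boolP (l < k)%N; last rewrite -leqNgt leq_eqVlt => /predU1P[kl|kl].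
  - have -> : minn l k = l by lia.
    have -> : minn l.+1 k = l.+1 by lia.
    have -> : (k < l)%N = false by lia.
    have -> : (k < l.+1)%N = false by lia.
    rewrite !addr0 -natr1 clamp01_ge1// ler_pdivlMr// mul1r lerD2r.
    apply: le_trans (increasing_upto_le inc lk (ltnW kL)) _.
    by case/andP: tk.
  - rewrite -kl minnn (minn_idPr (leqnSn k)) ltnn ltnSn addr0; congr (_ + _).
    by rewrite /t addrC addKr mulfK ?gt_eqF//; exact: clamp01_id.
  - have -> : minn l k = k by lia.
    have -> : minn l.+1 k = k by lia.
    have -> : (k < l.+1)%N = true by lia.
    rewrite kl clamp01_le0 ?addr0// ler_pdivrMr// mul0r subr_le0.
    have /andP[_ h] := tk; apply: le_trans h _.
    exact: increasing_upto_le inc kl (ltnW lL).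
by rewrite key// (minn_idPr (ltnW kL)) kL.
Qed.

Lemma pl_coord_node L x (k : nat) : increasing_upto L x -> (k <= L)%N -> (0 < L)%N ->
  pl_coord L x (x k) = k%:R.
Proof.
move=> inc; rewrite leq_eqVlt => /predU1P[->|kL] L0.
  have := @pl_coord_cell L x L.-1 1 inc; rewrite prednK// leqnn => /(_ isT).
  rewrite ler01 lexx => /(_ isT); rewrite mul1r addrC subrK => ->.
  by rewrite natr1 prednK.
by have := @pl_coord_cell L x k 0 inc kL; rewrite mul0r !addr0 ler01 lexx; apply.
Qed.

Lemma find_cell L x (t : R) : (0 < L)%N -> increasing_upto L x -> x 0%N <= t <= x L ->
  exists k (a : R), [/\ (k < L)%N, 0 <= a <= 1 & t = x k + a * (x k.+1 - x k)].
Proof.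
move=> L0 inc /andP[t0 tL].
have ex : exists k, (k < L)%N && (t <= x k.+1).
  by exists L.-1; rewrite prednK// leqnn.
have [k /andP[kL tk] kmin] := ex_minnP ex.
have dk : 0 < x k.+1 - x k by rewrite subr_gt0; exact: inc.
have kt : x k <= t.
  case: k kL tk kmin dk => [//|k] kL _ kmin _.
  rewrite leNgt; apply/negP => h.
  have := kmin k; rewrite (ltnW kL) (ltW h) => /(_ isT).
  by rewrite ltnn.
exists k, ((t - x k) / (x k.+1 - x k)); split => //.
  apply/andP; split; first by apply: divr_ge0; [rewrite subr_ge0|exact: ltW].
  by rewrite ler_pdivrMr// mul1r lerD2r.
by rewrite divfK ?gt_eqF// addrC subrK.
Qed.

Lemma continuous_pl_coord L x : continuous (pl_coord L x).
Proof.
have -> : pl_coord L x = (fun z : R => \sum_(i <- index_enum 'I_L) clamp01 ((z - x i) / (x i.+1 - x i))).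
  by [].
apply: continuous_sumr => i.
apply: continuous_comp1; last exact: continuous_clamp01.
apply: continuous_mulr; last by move=> t; exact: cvg_cst.
by move=> t; apply: cvgB; [exact: cvg_id|exact: cvg_cst].
Qed.

(** The Courant hat function at the origin for the integer grid cut along the direction (1, 1); its
    support is the hexagon formed by the six triangles around the origin. *)
Definition hat (a b : R) : R := posp (1 - Num.max `|a| (Num.max `|b| `|a - b|)).

Lemma hat_ge0 a b : 0 <= hat a b.
Proof. by rewrite /hat /posp le_max lexx. Qed.

Lemma hat0 a b : [|| 1 <= `|a|, 1 <= `|b| | 1 <= `|a - b|] -> hat a b = 0.
Proof.
by move=> h; rewrite /hat posp_le// subr_le0 !le_max.
Qed.

Lemma hat00 a b : 0 <= b -> b <= a -> a <= 1 -> hat a b = 1 - a.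
Proof.
move=> b0 ba a1; rewrite /hat !ger0_norm; [|lra|lra|lra].
have -> : Num.max a (Num.max b (a - b)) = a by apply: max_l; rewrite ge_max; lra.
by rewrite posp_ge; lra.
Qed.

Lemma hat10 a b : 0 <= b -> b <= a -> a <= 1 -> hat (a - 1) b = a - b.
Proof.
move=> b0 ba a1; rewrite /hat (@ler0_norm _ (a - 1)); last lra.
rewrite (@ger0_norm _ b)// (@ler0_norm _ (a - 1 - b)); last lra.
have -> : Num.max b (- (a - 1 - b)) = - (a - 1 - b) by apply: max_r; lra.
have -> : Num.max (- (a - 1)) (- (a - 1 - b)) = - (a - 1 - b) by apply: max_r; lra.
by rewrite posp_ge; lra.
Qed.

Lemma hat11 a b : 0 <= b -> b <= a -> a <= 1 -> hat (a - 1) (b - 1) = b.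
Proof.
move=> b0 ba a1; rewrite /hat (@ler0_norm _ (a - 1)); last lra.
rewrite (@ler0_norm _ (b - 1)); last lra.
rewrite (@ger0_norm _ (a - 1 - (b - 1))); last lra.
have -> : Num.max (- (a - 1)) (Num.max (- (b - 1)) (a - 1 - (b - 1))) = 1 - b.
  have [h|h] := leP (- (b - 1)) (a - 1 - (b - 1)).
    by rewrite max_r//; lra.
  by rewrite max_r; lra.
by rewrite posp_ge; lra.
Qed.

Lemma hatC a b : hat a b = hat b a.
Proof. by rewrite /hat [`|b - a|]distrC maxCA. Qed.

Lemma continuous_hat (T : topologicalType) (f g : T -> R) : continuous f -> continuous g ->
  continuous (fun z => hat (f z) (g z)).
Proof.
move=> cf cg; apply: (@continuous_comp1 R T _ posp _ continuous_posp).
apply: (@continuous_subr R T (fun=> 1)); first by move=> z; exact: cvg_cst.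
apply: continuous_maxr; first exact: continuous_absr.
by apply: continuous_maxr; apply: continuous_absr => //; exact: continuous_subr.
Qed.

End Partition.

Section Kuhn.
Context {R : realType} (L : nat) (x y : nat -> R).
Implicit Types (p q : R * R) (u : R * R -> R).

Definition node (i j : nat) : R * R := (x i, y j).

Definition kuhn_cell := (bool * 'I_L * 'I_L)%type.

(** The flag [true] selects the half below the diagonal. The first and last vertices are always the
    ends of the diagonal, so only the middle vertex depends on the flag. *)
Definition kuhn (c : kuhn_cell) : @triangle R :=
  let k := c.1.2 in let l := c.2 in
  if c.1.1 then [tuple node k l; node k.+1 l; node k.+1 l.+1]
  else [tuple node k l; node k l.+1; node k.+1 l.+1].

Definition kuhn_triangulation : seq triangle := [seq kuhn c | c <- enum {: kuhn_cell}].

Definition cell_point (k l : nat) (a b : R) : R * R :=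
  (x k + a * (x k.+1 - x k), y l + b * (y l.+1 - y l)).

Definition in_half (d : bool) (a b : R) : Prop :=
  if d then 0 <= b /\ b <= a /\ a <= 1 else 0 <= a /\ a <= b /\ b <= 1.

Lemma kuhn_hullP (c : kuhn_cell) p : convex_hull (kuhn c) p <->
  exists a b : R, in_half c.1.1 a b /\ p = cell_point c.1.2 c.2 a b.
Proof.
case: c => [[d k] l]; rewrite /kuhn /in_half /cell_point /=; case: d; rewrite convex_hull3P.
- split=> [[s [t [s0 t0 st ->]]]|[a [b [[b0 [ba a1]] ->]]]].
    exists (s + t), t; split; first by split=> //; lra.
    by apply/pair_equal_spec; split => /=; rewrite /GRing.scale/=; ring.
  exists (a - b), b; split; [lra|lra|lra|].
  by apply/pair_equal_spec; split => /=; rewrite /GRing.scale/=; ring.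
- split=> [[s [t [s0 t0 st ->]]]|[a [b [[a0 [ab b1]] ->]]]].
    exists t, (s + t); split; first by split=> //; lra.
    by apply/pair_equal_spec; split => /=; rewrite /GRing.scale/=; ring.
  exists (b - a), a; split; [lra|lra|lra|].
  by apply/pair_equal_spec; split => /=; rewrite /GRing.scale/=; ring.
Qed.

(** The hat function of the node [q]: on a triangle with vertex [q] it is the barycentric coordinate
    of [q], on the other triangles it is 0. Having one global function per node settles both the
    intersections of triangles and the continuity of interpolants. *)
Definition lam q p : R :=
  hat (pl_coord L x p.1 - pl_coord L x q.1) (pl_coord L y p.2 - pl_coord L y q.2).

Context (L0 : (0 < L)%N) (incx : increasing_upto L x) (incy : increasing_upto L y).

Lemma in_half_itv d a b : in_half d a b -> 0 <= a <= 1 /\ 0 <= b <= 1.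
Proof. by case: d => /= ?; lra. Qed.

Lemma lam_node (i j k l : nat) (a b : R) : (i <= L)%N -> (j <= L)%N -> (k < L)%N -> (l < L)%N ->
  0 <= a <= 1 -> 0 <= b <= 1 ->
  lam (node i j) (cell_point k l a b) = hat (k%:R + a - i%:R) (l%:R + b - j%:R).
Proof.
by move=> iL jL kL lL a01 b01; rewrite /lam /= !pl_coord_cell// !pl_coord_node.
Qed.

Lemma lam_kuhn (c : kuhn_cell) (a b : R) : in_half c.1.1 a b ->
  let k := c.1.2 in let l := c.2 in
  let p := cell_point k l a b in
  [/\ lam (node k l) p = 1 - (if c.1.1 then a else b),
      lam (kuhn c)`_1 p = (if c.1.1 then a - b else b - a)
    & lam (node k.+1 l.+1) p = (if c.1.1 then b else a)].
Proof.
move: c => [[d k] l] h; have [a01 b01] := in_half_itv h.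
have kL := ltn_ord k; have lL := ltn_ord l.
rewrite /kuhn /=; move: h; case: d => /= -[h1 [h2 h3]]; rewrite !lam_node ?(ltnW kL) ?(ltnW lL)//.
- have -> : k%:R + a - k%:R = a by ring.
  have -> : l%:R + b - l%:R = b by ring.
  have -> : k%:R + a - k.+1%:R = a - 1 by rewrite -natr1; ring.
  have -> : l%:R + b - l.+1%:R = b - 1 by rewrite -natr1; ring.
  by rewrite hat00// hat10// hat11.
- have -> : k%:R + a - k%:R = a by ring.
  have -> : l%:R + b - l%:R = b by ring.
  have -> : k%:R + a - k.+1%:R = a - 1 by rewrite -natr1; ring.
  have -> : l%:R + b - l.+1%:R = b - 1 by rewrite -natr1; ring.
  by rewrite hatC hat00// [hat a _]hatC hat10// hatC hat11.
Qed.

Lemma nat_dist_ge1 (i k : nat) (a : R) : 0 <= a <= 1 -> i != k -> i != k.+1 ->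
  1 <= `|k%:R + a - i%:R|.
Proof.
move=> a01 ik ik1; have [lt|] := ltnP i k.
  have : (i.+1%:R : R) <= k%:R by rewrite ler_nat.
  by rewrite -natr1 => h; apply: le_trans (ler_norm _); lra.
rewrite leq_eqVlt eq_sym (negbTE ik)/= leq_eqVlt eq_sym (negbTE ik1)/= => h.
have : (k.+2%:R : R) <= i%:R by rewrite ler_nat.
by rewrite -!natr1 => h'; rewrite -normrN; apply: le_trans (ler_norm _); lra.
Qed.

(** A node outside the cell is at distance at least 1 in one of the coordinates. The off-diagonal
    corner of the opposite half is excluded by the third term of [hat]. *)
Lemma lam_out (c : kuhn_cell) (i j : nat) p : (i <= L)%N -> (j <= L)%N ->
  convex_hull (kuhn c) p -> node i j \notin (kuhn c : seq (R * R)) -> lam (node i j) p = 0.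
Proof.
move=> iL jL /kuhn_hullP[a [b [h ->]]] nin.
have [a01 b01] := in_half_itv h.
rewrite lam_node ?ltn_ord//; apply: hat0.
have [ik|ik] := eqVneq i c.1.2; last first.
  have [ik1|ik1] := eqVneq i c.1.2.+1; last by rewrite nat_dist_ge1.
  have [jl|jl] := eqVneq j c.2; last first.
    have [jl1|jl1] := eqVneq j c.2.+1; last by rewrite (nat_dist_ge1 b01) ?orbT.
    by move: nin; rewrite ik1 jl1 /kuhn; case: ifP => _; rewrite !inE eqxx ?orbT.
  move: nin h; rewrite ik1 jl /kuhn /in_half; case: ifP => _; rewrite !inE ?eqxx ?orbT// => _ h.
  apply/orP; right; apply/orP; right; rewrite -normrN; apply: le_trans (ler_norm _).
  by rewrite -natr1; lra.
have [jl|jl] := eqVneq j c.2.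
  by move: nin; rewrite ik jl /kuhn; case: ifP => _; rewrite !inE eqxx ?orbT.
have [jl1|jl1] := eqVneq j c.2.+1; last by rewrite (nat_dist_ge1 b01) ?orbT.
move: nin h; rewrite ik jl1 /kuhn /in_half; case: ifP => _; rewrite !inE ?eqxx ?orbT// => _ h.
apply/orP; right; apply/orP; right; apply: le_trans (ler_norm _).
by rewrite -natr1; lra.
Qed.

Lemma kuhn_node (c : kuhn_cell) q : q \in (kuhn c : seq (R * R)) ->
  exists i j, [/\ (i <= L)%N, (j <= L)%N & q = node i j].
Proof.
have kL := ltn_ord c.1.2; have lL := ltn_ord c.2.
rewrite /kuhn; case: ifP => _; rewrite !inE => /or3P[] /eqP ->.
- by exists c.1.2, c.2; split => //; exact: ltnW.
- by exists c.1.2.+1, c.2; split => //; exact: ltnW.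
- by exists c.1.2.+1, c.2.+1.
- by exists c.1.2, c.2; split => //; exact: ltnW.
- by exists c.1.2, c.2.+1; split => //; exact: ltnW.
- by exists c.1.2.+1, c.2.+1.
Qed.

Lemma kuhn_uniq (c : kuhn_cell) : uniq (kuhn c : seq (R * R)).
Proof.
have hx := incx (ltn_ord c.1.2); have hy := incy (ltn_ord c.2).
have nx := lt_eqF hx; have ny := lt_eqF hy.
by rewrite /kuhn; case: ifP => _ /=; rewrite !inE !xpair_eqE !eqxx nx ny ?andbF.
Qed.

Lemma kuhn_sum (V : lmodType R) (F : R * R -> V) (c : kuhn_cell) :
  \sum_(q <- (kuhn c : seq (R * R))) F q =
  F (node c.1.2 c.2) + F (kuhn c)`_1 + F (node c.1.2.+1 c.2.+1).
Proof.
by rewrite /kuhn; case: ifP => _ /=; rewrite !big_cons big_nil addr0 addrA.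
Qed.

Lemma lam_barycentric (c : kuhn_cell) p : convex_hull (kuhn c) p ->
  \sum_(q <- (kuhn c : seq (R * R))) lam q p = 1 /\
  \sum_(q <- (kuhn c : seq (R * R))) lam q p *: q = p.
Proof.
move=> /kuhn_hullP[a [b [h ->]]].
have [e0 e1 e2] := lam_kuhn h.
rewrite (@kuhn_sum R^o (fun q => lam q _)) kuhn_sum e0 e1 e2.
rewrite /cell_point /kuhn; case: ifP => _; split.
- by ring.
- by apply/pair_equal_spec; split => /=; rewrite /GRing.scale/=; ring.
- by ring.
- by apply/pair_equal_spec; split => /=; rewrite /GRing.scale/=; ring.
Qed.

(** A common point has the same weights [lam] in both triangles, and those of vertices not shared
    vanish; it is thus a convex combination of the shared vertices. *)
Lemma kuhn_intersection (c c' : kuhn_cell) :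
  convex_hull (kuhn c) `&` convex_hull (kuhn c') =
  convex_hull [seq p <- kuhn c | p \in (kuhn c' : seq (R * R))].
Proof.
have uf : uniq [seq p <- kuhn c | p \in (kuhn c' : seq (R * R))].
  by rewrite filter_uniq ?kuhn_uniq.
apply/seteqP; split => p; last first.
  move=> hp; split; apply: hull_mono hp => //; try exact: kuhn_uniq.
  - by move=> q; rewrite mem_filter => /andP[].
  - by move=> q; rewrite mem_filter => /andP[].
move=> [hp hp']; apply/(hull_weightsP _ uf); exists (lam ^~ p).
have [l1 l2] := lam_barycentric hp.
have z q : q \in (kuhn c : seq (R * R)) -> q \notin [seq p <- kuhn c | p \in (kuhn c' : seq (R * R))] -> lam q p = 0.
  move=> qc; rewrite mem_filter qc andbT => qc'.
  have [i [j [iL jL E]]] := kuhn_node qc.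
  by rewrite E in qc' *; exact: lam_out hp' qc'.
have sub : {subset [seq p <- kuhn c | p \in (kuhn c' : seq (R * R))] <= (kuhn c : seq (R * R))}.
  by move=> q; rewrite mem_filter => /andP[].
split.
- by move=> q; exact: hat_ge0.
- by rewrite -(big_uniq_sub uf (kuhn_uniq c) sub)// z.
- rewrite -(big_uniq_sub uf (kuhn_uniq c) sub)// => q qc /(z _ qc) ->.
  by rewrite scale0r.
Qed.

Lemma kuhn_nondegenerate (c : kuhn_cell) : nondegenerate (kuhn c).
Proof.
have := incx (ltn_ord c.1.2); have := incy (ltn_ord c.2).
rewrite -subr_gt0 => hy; rewrite -subr_gt0 => hx.
rewrite nondegenerateE /tdet /cross /kuhn; case: ifP => _ /=.
  by rewrite !subrr mul0r subr0 mulf_neq0// gt_eqF.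
by rewrite !subrr mul0r sub0r oppr_eq0 mulf_neq0// gt_eqF.
Qed.

(** The sums of the grid indices over the vertices ignore their order. They are 3k+2 and 3l+1 below
    the diagonal, 3k+1 and 3l+2 above it, so residues modulo 3 give the half and quotients give the
    cell. *)
Lemma kuhn_perm_inj (c c' : kuhn_cell) : perm_eq (kuhn c) (kuhn c') -> c = c'.
Proof.
have S1 (c0 : kuhn_cell) : \sum_(q <- (kuhn c0 : seq (R * R))) pl_coord L x q.1 =
    (3 * c0.1.2 + c0.1.1.+1)%:R.
  rewrite (@kuhn_sum R^o (fun q => pl_coord L x q.1)) /= /kuhn.
  have kL := ltn_ord c0.1.2.
  by case: c0.1.1 => /=; rewrite !pl_coord_node ?(ltnW kL)// -!natrD; congr (_%:R); lia.
have S2 (c0 : kuhn_cell) : \sum_(q <- (kuhn c0 : seq (R * R))) pl_coord L y q.2 =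
    (3 * c0.2 + (~~ c0.1.1).+1)%:R.
  rewrite (@kuhn_sum R^o (fun q => pl_coord L y q.2)) /= /kuhn.
  have lL := ltn_ord c0.2.
  by case: c0.1.1 => /=; rewrite !pl_coord_node ?(ltnW lL)// -!natrD; congr (_%:R); lia.
move=> pe.
have /eqP := perm_big _ pe : \sum_(q <- (kuhn c : seq (R * R))) pl_coord L x q.1 = _.
rewrite !S1 eqr_nat => /eqP e1.
have /eqP := perm_big _ pe : \sum_(q <- (kuhn c : seq (R * R))) pl_coord L y q.2 = _.
rewrite !S2 eqr_nat => /eqP e2.
case: c c' {pe} e1 e2 => [[d k] l] [[d' k'] l'] /= e1 e2.
have dE : d = d' by case: d d' e1 e2 => [] [] /=; lia.
have kE : k = k' by apply: val_inj => /=; rewrite dE in e1; lia.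
have lE : l = l' by apply: val_inj => /=; rewrite dE in e2; lia.
by rewrite dE kE lE.
Qed.

Context (x0 : x 0%N = 0) (xL : x L = 1) (y0 : y 0%N = 0) (yL : y L = 1).

Lemma kuhn_cover : unit_square = \bigcup_(T in [set` kuhn_triangulation]) convex_hull T.
Proof.
apply/seteqP; split => p.
  move=> /unit_squareP[p1 p2].
  have [|k [a [kL a01 pa]]] := @find_cell R L x p.1 L0 incx; first by rewrite x0 xL.
  have [|l [b [lL b01 pb]]] := @find_cell R L y p.2 L0 incy; first by rewrite y0 yL.
  exists (kuhn (b <= a, Ordinal kL, Ordinal lL)) => /=.
    by apply/mapP; exists (b <= a, Ordinal kL, Ordinal lL) => //; rewrite mem_enum.
  apply/kuhn_hullP; exists a, b; split; last by rewrite /cell_point /= -pa -pb; case: (p).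
  by rewrite /in_half /=; case: leP => ab; lra.
move=> [_ /= /mapP[c _ ->]] /kuhn_hullP[a [b [h ->]]]; have [a01 b01] := in_half_itv h.
have kL := ltn_ord c.1.2; have lL := ltn_ord c.2.
have x1 := increasing_upto_le incx (leq0n c.1.2) (ltnW kL).
have x2 := increasing_upto_le incx kL (leqnn L).
have y1 := increasing_upto_le incy (leq0n c.2) (ltnW lL).
have y2 := increasing_upto_le incy lL (leqnn L).
have x3 := incx kL; have y3 := incy lL.
rewrite x0 in x1; rewrite y0 in y1; rewrite xL in x2; rewrite yL in y2.
by apply/unit_squareP; split => /=; apply/andP; split; nra.
Qed.

Lemma kuhn_is_triangulation : is_triangulation unit_square kuhn_triangulation.
Proof.
split.
- by move=> _ /mapP[c _ ->]; exact: kuhn_nondegenerate.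
- exact: kuhn_cover.
- rewrite pairwise_map; have := enum_uniq {: kuhn_cell}; rewrite uniq_pairwise.
  apply: sub_pairwise => c c' /=; apply: contraNN => /kuhn_perm_inj ->.
  exact: eqxx.
- by move=> _ _ /mapP[c _ ->] /mapP[c' _ ->]; exact: kuhn_intersection.
Qed.

(** A finite sum of hats is continuous without any gluing of affine pieces; [undup] counts a vertex
    shared by several triangles once. *)
Definition kuhn_interpolant u p : R :=
  \sum_(q <- undup (flatten (map (@tval 3 (R * R)) kuhn_triangulation))) u q * lam q p.

Lemma kuhn_interpolantE u (c : kuhn_cell) (a b : R) : in_half c.1.1 a b ->
  kuhn_interpolant u (cell_point c.1.2 c.2 a b) =
  u (node c.1.2 c.2) * (1 - (if c.1.1 then a else b)) +
  u (kuhn c)`_1 * (if c.1.1 then a - b else b - a) +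
  u (node c.1.2.+1 c.2.+1) * (if c.1.1 then b else a).
Proof.
move=> h; set p := cell_point _ _ _ _.
have hp : convex_hull (kuhn c) p by apply/kuhn_hullP; exists a, b.
have [e0 e1 e2] := lam_kuhn h.
rewrite /kuhn_interpolant (big_uniq_sub (kuhn_uniq c))//.
- by rewrite (@kuhn_sum R^o (fun q => u q * lam q p)) -/p e0 e1 e2.
- exact: undup_uniq.
- move=> q qc; rewrite mem_undup; apply/flattenP; exists (tval (kuhn c)) => //.
  by apply/mapP; exists (kuhn c) => //; apply: map_f; rewrite mem_enum.
move=> q; rewrite mem_undup => /flattenP[_ /mapP[_ /mapP[c' _ ->] ->] qc'] qc.
have [i [j [iL jL E]]] := kuhn_node qc'.
by rewrite E in qc *; rewrite (lam_out iL jL hp qc) mulr0.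
Qed.

Lemma kuhn_interpolates u : interpolates unit_square u kuhn_triangulation (kuhn_interpolant u).
Proof.
split.
- apply: continuous_subspaceT; apply: continuous_sumr => q; apply: continuous_mulr.
    by move=> p; exact: cvg_cst.
  apply: continuous_hat.
    apply: (@continuous_subr R _ (fun p : R * R => pl_coord L x p.1) (fun=> pl_coord L x q.1)).
      exact: (continuous_comp1 continuous_fst1 (@continuous_pl_coord R L x)).
    by move=> p; exact: cvg_cst.
  apply: (@continuous_subr R _ (fun p : R * R => pl_coord L y p.2) (fun=> pl_coord L y q.2)).
    exact: (continuous_comp1 continuous_snd1 (@continuous_pl_coord R L y)).
  by move=> p; exact: cvg_cst.
- move=> _ /mapP[c _ ->].
  have := incx (ltn_ord c.1.2); rewrite -subr_gt0 => dx0.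
  have := incy (ltn_ord c.2); rewrite -subr_gt0 => dy0.
  pose u0 := u (node c.1.2 c.2); pose u1 := u (kuhn c)`_1; pose u2 := u (node c.1.2.+1 c.2.+1).
  (* The edges at the middle vertex are parallel to the axes, so both slopes are difference
     quotients along edges. *)
  pose A := (if c.1.1 then u1 - u0 else u2 - u1) / (x c.1.2.+1 - x c.1.2).
  pose B := (if c.1.1 then u2 - u1 else u1 - u0) / (y c.2.+1 - y c.2).
  exists A, B, (u0 - A * x c.1.2 - B * y c.2) => p /kuhn_hullP[a [b [h ->]]].
  rewrite kuhn_interpolantE// -/u0 -/u1 -/u2 /cell_point /A /B /=.
  move: (x c.1.2.+1) (x c.1.2) (y c.2.+1) (y c.2) dx0 dy0 => X1 X Y1 Y dx0 dy0.
  by case: c.1.1; field; rewrite !gt_eqF.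
- move=> _ /mapP[c _ ->] q qc.
  have : exists a b : R, in_half c.1.1 a b /\ q = cell_point c.1.2 c.2 a b /\
     u q = u (node c.1.2 c.2) * (1 - (if c.1.1 then a else b)) +
        u (kuhn c)`_1 * (if c.1.1 then a - b else b - a) +
        u (node c.1.2.+1 c.2.+1) * (if c.1.1 then b else a); last first.
    by move=> [a [b [h [qE uE]]]]; rewrite uE [in LHS]qE kuhn_interpolantE.
  have corner (s t : bool) : node (c.1.2 + s) (c.2 + t) = cell_point c.1.2 c.2 s%:R t%:R.
    by rewrite /node /cell_point; case: s; case: t; rewrite ?addn1 ?addn0 /= ?mul1r ?mul0r ?addr0 1?addrC ?subrK 1?[y _ + _]addrC ?subrK.
  have := corner false false; have := corner true false; have := corner false true.
  have := corner true true; rewrite !addn1 !addn0 => c11 c01 c10 c00.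
  move: qc; rewrite /kuhn /in_half; case: ifP => _; rewrite !inE => /or3P[] /eqP -> /=.
  - by exists 0, 0; rewrite c00; split; [lra|split => //; ring].
  - by exists 1, 0; rewrite c10; split; [lra|split => //; ring].
  - by exists 1, 1; rewrite c11; split; [lra|split => //; ring].
  - by exists 0, 0; rewrite c00; split; [lra|split => //; ring].
  - by exists 0, 1; rewrite c01; split; [lra|split => //; ring].
  - by exists 1, 1; rewrite c11; split; [lra|split => //; ring].
Qed.

End Kuhn.

Section KuhnSize.
Context {R : realType} (L : nat) (x y : nat -> R).
Implicit Types (p q : R * R) (u v : R * R -> R).
Context (L0 : (0 < L)%N) (incx : increasing_upto L x) (incy : increasing_upto L y).
Context (x0 : x 0%N = 0) (xL : x L = 1) (y0 : y 0%N = 0) (yL : y L = 1).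
Context (d : R) (dx_le : forall k, (k < L)%N -> x k.+1 - x k <= d)
  (dy_le : forall k, (k < L)%N -> y k.+1 - y k <= d).

Let cover := kuhn_cover L0 incx incy x0 xL y0 yL.

Lemma kuhn_mesh : 0 <= mesh (kuhn_triangulation L x y) <= 2 * d.
Proof.
pose c0 : kuhn_cell L := (true, Ordinal L0, Ordinal L0).
have c0D : kuhn x y c0 \in kuhn_triangulation L x y by apply: map_f; rewrite mem_enum.
apply/andP; split.
  apply: le_trans (hull_dist_le_mesh cover c0D (mem_hull0 _) (mem_hull0 _)).
  exact: sqrtr_ge0.
apply: ge_sup; first by exists (diam (convex_hull (kuhn x y c0))); exists (kuhn x y c0).
move=> _ [_ /= /mapP[c _ ->] <-]; apply: diam_le.
  by exists (kuhn x y c)`_0; exact: mem_hull0.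
move=> p q /kuhn_hullP[a [b [/in_half_itv[a01 b01] ->]]] /kuhn_hullP[a' [b' [/in_half_itv[a'01 b'01] ->]]].
apply: le_trans (enorm_le _) _ => /=.
have hx := incx (ltn_ord c.1.2); have hy := incy (ltn_ord c.2).
have hx' := dx_le (ltn_ord c.1.2); have hy' := dy_le (ltn_ord c.2).
have step (X X1 s t : R) : X < X1 -> X1 - X <= d -> 0 <= s <= 1 -> 0 <= t <= 1 ->
    `|X + s * (X1 - X) - (X + t * (X1 - X))| <= d.
  move=> h1 h2 s01 t01; have -> : X + s * (X1 - X) - (X + t * (X1 - X)) = (s - t) * (X1 - X) by ring.
  rewrite normrM [`|X1 - X|]gtr0_norm ?subr_gt0//; apply: le_trans h2.
  by rewrite ler_piMl ?subr_ge0 ?(ltW h1)// ler_norml; lra.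
have -> : 2 * d = d + d by ring.
by apply: lerD; exact: step.
Qed.

Lemma sqrt_sum_squares_le (A B C : R) : Num.sqrt (A ^+ 2 + B ^+ 2 + C ^+ 2) <= `|A| + `|B| + `|C|.
Proof.
rewrite -(@ger0_norm _ (`|A| + `|B| + `|C|)) ?addr_ge0// -sqrtr_sqr.
apply: ler_wsqrtr; rewrite -(real_normK (num_real A)) -(real_normK (num_real B)) -(real_normK (num_real C)).
move: (normr_ge0 A) (normr_ge0 B) (normr_ge0 C).
by move: `|A| `|B| `|C| => a b c a0 b0 c0; nra.
Qed.

Definition xdiff v (k l : nat) := `|v (node x y k.+1 l) - v (node x y k l)|.
Definition ydiff v (k l : nat) := `|v (node x y k l.+1) - v (node x y k l)|.

(** Two edges project to segments parallel to the axes, of lengths X and Y; the components of the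
    cross product are then, up to sign, XY and the two increments of [v] multiplied by X or Y. *)
Lemma kuhn_triangle_area v (c : kuhn_cell L) : let T := kuhn x y c in
  triangle_area3 (T`_0, v T`_0) (T`_1, v T`_1) (T`_2, v T`_2) <=
  (d ^+ 2 + d * (if c.1.1 then xdiff v c.1.2 c.2 + ydiff v c.1.2.+1 c.2
                 else ydiff v c.1.2 c.2 + xdiff v c.1.2 c.2.+1)) / 2.
Proof.
have := incx (ltn_ord c.1.2); have := incy (ltn_ord c.2).
rewrite -subr_gt0 => hy; rewrite -subr_gt0 => hx.
have hx' := dx_le (ltn_ord c.1.2); have hy' := dy_le (ltn_ord c.2).
rewrite /triangle_area3 ler_pM2r ?invr_gt0//.
apply: le_trans (sqrt_sum_squares_le _ _ _) _.
rewrite /kuhn /xdiff /ydiff; case: ifP => _ /=; rewrite !subrr.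
- set u00 := v (node x y c.1.2 c.2); set u10 := v (node x y c.1.2.+1 c.2).
  set u11 := v (node x y c.1.2.+1 c.2.+1).
  move: (x c.1.2.+1 - x c.1.2) (y c.2.+1 - y c.2) hx hy hx' hy' => X Y hx hy hx' hy'.
  have -> : 0 * (u11 - u00) - (u10 - u00) * Y = - (Y * (u10 - u00)) by ring.
  have -> : (u10 - u00) * X - X * (u11 - u00) = - (X * (u11 - u10)) by ring.
  rewrite mul0r subr0 !normrN !normrM !(gtr0_norm hx) !(gtr0_norm hy).
  move: (normr_ge0 (u10 - u00)) (normr_ge0 (u11 - u10)).
  by move: `|u10 - u00| `|u11 - u10| => s t s0 t0; nra.
- set u00 := v (node x y c.1.2 c.2); set u01 := v (node x y c.1.2 c.2.+1).
  set u11 := v (node x y c.1.2.+1 c.2.+1).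
  move: (x c.1.2.+1 - x c.1.2) (y c.2.+1 - y c.2) hx hy hx' hy' => X Y hx hy hx' hy'.
  have -> : Y * (u11 - u00) - (u01 - u00) * Y = Y * (u11 - u01) by ring.
  have -> : (u01 - u00) * X - 0 * (u11 - u00) = X * (u01 - u00) by ring.
  rewrite mul0r sub0r !normrN !normrM !(gtr0_norm hx) !(gtr0_norm hy).
  move: (normr_ge0 (u01 - u00)) (normr_ge0 (u11 - u01)).
  by move: `|u01 - u00| `|u11 - u01| => s t s0 t0; nra.
Qed.

(** Every grid edge borders at most two triangles, which absorbs the factor 1/2, and the two halves
    of each of the L^2 cells contribute d^2 together. *)
Lemma kuhn_area v : 0 <= d ->
  polyhedral_area (kuhn_triangulation L x y) v <= (L%:R * d) ^+ 2 +
   d * (\sum_(k < L) \sum_(l < L.+1) xdiff v k l + \sum_(l < L) \sum_(k < L.+1) ydiff v k l).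
Proof.
move=> d0; rewrite /polyhedral_area big_map big_enum/=.
apply: le_trans (ler_sum _ (fun c _ => kuhn_triangle_area v c)) _.
rewrite -(pair_bigA _ (fun (bk : bool * 'I_L) (l : 'I_L) =>
  (d ^+ 2 + d * (if bk.1 then xdiff v bk.2 l + ydiff v bk.2.+1 l
                 else ydiff v bk.2 l + xdiff v bk.2 l.+1)) / 2))/=.
rewrite -(pair_bigA _ (fun (b : bool) (k : 'I_L) => \sum_(l < L)
  (d ^+ 2 + d * (if b then xdiff v k l + ydiff v k.+1 l
                 else ydiff v k l + xdiff v k l.+1)) / 2))/=.
rewrite big_bool/= -big_split/=.
pose F (k l : 'I_L) := d ^+ 2 + d / 2 * (xdiff v k l + ydiff v k.+1 l + ydiff v k l + xdiff v k l.+1).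
rewrite (_ : \sum_(k < L) _ = \sum_(k < L) \sum_(l < L) F k l); last first.
  apply: eq_bigr => k _; rewrite -big_split/=; apply: eq_bigr => l _.
  by rewrite /F; field.
have H0 k l : 0 <= xdiff v k l by exact: normr_ge0.
have W0 k l : 0 <= ydiff v k l by exact: normr_ge0.
pose SH := \sum_(k < L) \sum_(l < L.+1) xdiff v k l.
pose SW := \sum_(l < L) \sum_(k < L.+1) ydiff v k l.
have h1 : \sum_(k < L) \sum_(l < L) xdiff v k l <= SH.
  by apply: ler_sum => k _; rewrite big_ord_recr/= lerDl.
have h2 : \sum_(k < L) \sum_(l < L) xdiff v k l.+1 <= SH.
  by apply: ler_sum => k _; rewrite big_ord_recl/= lerDr.
have h3 : \sum_(k < L) \sum_(l < L) ydiff v k l <= SW.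
  by rewrite exchange_big/=; apply: ler_sum => l _; rewrite big_ord_recr/= lerDl.
have h4 : \sum_(k < L) \sum_(l < L) ydiff v k.+1 l <= SW.
  by rewrite exchange_big/=; apply: ler_sum => l _; rewrite big_ord_recl/= lerDr.
have -> : \sum_(k < L) \sum_(l < L) F k l = (L%:R * d) ^+ 2 + d / 2 *
   (\sum_(k < L) \sum_(l < L) xdiff v k l + \sum_(k < L) \sum_(l < L) ydiff v k.+1 l +
    \sum_(k < L) \sum_(l < L) ydiff v k l + \sum_(k < L) \sum_(l < L) xdiff v k l.+1).
  have -> : (L%:R * d) ^+ 2 = \sum_(k < L) \sum_(l < L) d ^+ 2.
    by rewrite !sumr_const card_ord -mulrnA exprMn -[RHS]mulr_natl natrM expr2.
  rewrite -!big_split/= mulr_sumr -big_split/=; apply: eq_bigr => k _.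
  by rewrite -!big_split/= mulr_sumr -big_split/=.
rewrite lerD2l -/SH -/SW.
have -> : d * (SH + SW) = d / 2 * (SH + SW + SW + SH) by field.
apply: ler_wpM2l; first by rewrite divr_ge0.
lra.
Qed.

End KuhnSize.

(** * Bounded variation implies finite relaxed area *)

Section BVToRelaxed.
Context {R : realType}.
Implicit Types (u U v : R * R -> R).
Notation S := (@unit_square R)^°.

(** The n+1 translated nodes get the indices 1 to n+1 between the added endpoints 0 and 1, so there
    are n+2 cells; for an offset strictly between 0 and 1/(n+1) none is longer than 1/(n+1). *)
Definition bordered_grid (n : nat) (s : R) (i : nat) : R :=
  if i is i'.+1 then if (i' <= n)%N then shifted_grid n s i' else 1 else 0.

Lemma bordered_grid_step (n : nat) (s : R) (k : nat) : 0 < s < n.+1%:R^-1 -> (k < n.+2)%N ->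
  0 < bordered_grid n s k.+1 - bordered_grid n s k <= n.+1%:R^-1.
Proof.
move=> /andP[s0 s1]; have N0 : 0 < n.+1%:R :> R by rewrite ltr0n.
case: k => [_|k] /=.
  by rewrite /shifted_grid mul0r add0r subr0 s0 ltW.
rewrite !ltnS => kn1; have [->|kn2] := eqVneq k n.
  rewrite ltnn leqnn /shifted_grid.
  have -> : n%:R / n.+1%:R = 1 - n.+1%:R^-1 :> R.
    by rewrite -[X in X / _](addrK 1) natr1 mulrBl divff ?gt_eqF// div1r.
  by move: s0 s1; move: (n.+1%:R^-1) => r ? ?; lra.
have kn : (k < n)%N by rewrite ltn_neqAle kn2.
rewrite kn kn1 /shifted_grid -natr1 mulrDl div1r.
have : 0 < n.+1%:R^-1 :> R by rewrite invr_gt0.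
by move: (n.+1%:R^-1) (k%:R / _) => r w r0; lra.
Qed.

Lemma bordered_grid_increasing (n : nat) (s : R) : 0 < s < n.+1%:R^-1 ->
  increasing_upto n.+2 (bordered_grid n s).
Proof.
by move=> s01 k kn; have /andP[] := bordered_grid_step s01 kn; rewrite subr_gt0.
Qed.

(* All but the boundary strips of the grid is governed by [grid_variation];
   the [O(n)] remaining edges are bounded trivially. *)
Lemma sum_with_boundary (F : nat -> nat -> R) (n : nat) (M : R) : 0 <= M ->
  (forall k l, 0 <= F k l <= M) ->
  \sum_(k < n.+2) \sum_(l < n.+3) F k l <=
  \sum_(i < n) \sum_(j < n.+1) F i.+1 j.+1 + 6 * n.+1%:R * M.
Proof.
move=> M0 FM.
have F1 k l : F k l <= M by case/andP: (FM k l).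
have row k : \sum_(l < n.+3) F k l <= n.+3%:R * M.
  apply: (@le_trans _ _ (\sum_(l < n.+3) M)); first by apply: ler_sum.
  by rewrite sumr_const card_ord -[leLHS]mulr_natl.
have inner k : \sum_(l < n.+3) F k l <= \sum_(j < n.+1) F k j.+1 + 2 * M.
  rewrite big_ord_recl big_ord_recr/=.
  have := F1 k 0%N; have := F1 k n.+2.
  rewrite /bump /= add1n.
  have -> : \sum_(i < n.+1) F k (1 + i)%N = \sum_(i < n.+1) F k i.+1 by [].
  lra.
rewrite big_ord_recl [X in _ + X]big_ord_recr/=.
have h : \sum_(i < n) \sum_(l < n.+3) F (bump 0 i) l <=
   \sum_(i < n) (\sum_(j < n.+1) F i.+1 j.+1 + 2 * M).
  by apply: ler_sum => i _; exact: inner.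
rewrite big_split/= sumr_const card_ord -[_ *+ n]mulr_natl in h.
(* Two extreme rows at (n+3)M each and n inner rows at 2M each cost (4n+6)M, at most 6(n+1)M. *)
have r1 := row 0%N; have r2 := row (bump 0 n).
have e1 : n.+1%:R = n%:R + 1 :> R by rewrite natr1.
have e3 : n.+3%:R = n%:R + 3 :> R by rewrite -!natr1; ring.
rewrite e3 in r1 r2; rewrite e1.
have : 0 <= n%:R * M by rewrite mulr_ge0.
by move: h r1 r2; rewrite /bump !add1n; lra.
Qed.

Lemma ext_bounded u : {within unit_square, continuous u} ->
  exists2 M : R, 0 <= M & forall p, `|ext u p| <= M.
Proof.
move=> cu; have [M M0 hM] := continuous_bounded (ext_continuous cu).
exists M => // p.
have -> : ext u p = ext u (clamp01 p.1, clamp01 p.2).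
  by rewrite /ext /= !(clamp01_id (clamp01_itv _)).
by apply: hM; apply/unit_squareP; split; exact: clamp01_itv.
Qed.

Lemma BV_inscribed_bound u : {within unit_square, continuous u} -> BV S u ->
  exists C : R, forall n : nat, exists Dv : seq (@triangle R) * (R * R -> R),
  [/\ is_triangulation unit_square Dv.1, interpolates unit_square u Dv.1 Dv.2,
      0 <= mesh Dv.1 <= 2 * n.+1%:R^-1 & polyhedral_area Dv.1 Dv.2 <= C].
Proof.
move=> cu bv; have cU := ext_continuous cu.
have [V [V0 hx hy]] := BV_x_variation cu bv.
have [M M0 hM] := ext_bounded cu.
(* The 4 bounds ((n+2)/(n+1))^2, the planar part of the area; the second term is the grid variation
   times the step 1/(n+1); 24M = 2 * 6 * 2M comes from the boundary strips in the two directions,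
   each jump being at most 2M. *)
exists (4 + 2 * (32 * V + 2) + 24 * M) => n.
have [s [t [s01 t01 gv]]] := grid_offset n cU hx hy.
pose x := bordered_grid n s; pose y := bordered_grid n t.
have incx := bordered_grid_increasing s01; have incy := bordered_grid_increasing t01.
have xL : x n.+2 = 1 by rewrite /x /= ltnn.
have yL : y n.+2 = 1 by rewrite /y /= ltnn.
have N0 : 0 < n.+1%:R^-1 :> R by rewrite invr_gt0.
have N1 : 0 < n.+1%:R :> R by rewrite ltr0n.
have dxl k : (k < n.+2)%N -> x k.+1 - x k <= n.+1%:R^-1.
  by move=> kn; have /andP[] := bordered_grid_step s01 kn.
have dyl k : (k < n.+2)%N -> y k.+1 - y k <= n.+1%:R^-1.
  by move=> kn; have /andP[] := bordered_grid_step t01 kn.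
pose D := kuhn_triangulation n.+2 x y.
pose v := kuhn_interpolant n.+2 x y (ext u).
have tri : is_triangulation unit_square D.
  exact: kuhn_is_triangulation (ltn0Sn n.+1) incx incy erefl xL erefl yL.
have [cv av vv] : interpolates unit_square (ext u) D v.
  exact: kuhn_interpolates (ltn0Sn n.+1) incx incy _.
have [_ cov _ _] := tri.
exists (D, v); split => //=.
- split => // T TD q qT; rewrite (vv T TD q qT) ext_id// cov; exists T => //.
  have : q \in [:: T`_0; T`_1; T`_2] by rewrite -tupleE3.
  rewrite !inE => /or3P[] /eqP ->; [exact: mem_hull0|exact: mem_hull1|exact: mem_hull2].
- have := kuhn_mesh (ltn0Sn n.+1) incx incy erefl xL erefl yL dxl dyl; exact.
have -> : polyhedral_area D v = polyhedral_area D (ext u).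
  rewrite /polyhedral_area big_seq [RHS]big_seq; apply: eq_bigr => T TD.
  have memT (i : nat) : (i < 3)%N -> T`_i \in (T : seq _) by move=> ?; rewrite mem_nth// size_tuple.
  by rewrite (vv T TD _ (memT 0 isT)) (vv T TD _ (memT 1 isT)) (vv T TD _ (memT 2 isT)).
apply: le_trans (kuhn_area incx incy dxl dyl _ (ltW N0)) _.
have diff p q : 0 <= `|ext u p - ext u q| <= 2 * M.
  rewrite normr_ge0/=; apply: le_trans (ler_normB _ _) _.
  by have := hM p; have := hM q; lra.
have M20 : 0 <= 2 * M by lra.
have b1 := @sum_with_boundary (fun k l => `|ext u (node x y k.+1 l) - ext u (node x y k l)|) n _ M20
  (fun k l => diff _ _).
have b2 := @sum_with_boundary (fun l k => `|ext u (node x y k l.+1) - ext u (node x y k l)|) n _ M20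
  (fun k l => diff _ _).
have e1 : \sum_(i < n) \sum_(j < n.+1) `|ext u (node x y i.+2 j.+1) - ext u (node x y i.+1 j.+1)| +
  \sum_(j < n) \sum_(i < n.+1) `|ext u (node x y i.+1 j.+2) - ext u (node x y i.+1 j.+1)| =
  grid_variation (ext u) n s t.
  rewrite /grid_variation /node /x /y /=; congr (_ + _).
    apply: eq_bigr => i _; apply: eq_bigr => j _.
    by rewrite (ltn_ord i) (ltnW (ltn_ord i)) -ltnS (ltn_ord j).
  apply: eq_bigr => j _; apply: eq_bigr => i _.
  by rewrite (ltn_ord j) (ltnW (ltn_ord j)) -ltnS (ltn_ord i).
have sq : (n.+2%:R * n.+1%:R^-1) ^+ 2 <= 4 :> R.
  have h1 : n.+2%:R * n.+1%:R^-1 <= 2 :> R.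
    by rewrite ler_pdivrMr// -natrM ler_nat mul2n -addnn addSn ltnS leq_addl.
  have h0 : 0 <= n.+2%:R * n.+1%:R^-1 :> R by rewrite mulr_ge0// ltW.
  by move: h0 h1; move: (_ * _) => z ? ?; nra.
have -> : 4 + 2 * (32 * V + 2) + 24 * M = 4 + n.+1%:R^-1 * (2 * (32 * V + 2) * n.+1%:R + 2 * (6 * n.+1%:R * (2 * M))).
  by move: N1; move: (n.+1%:R) => N N1; field; rewrite gt_eqF.
apply: lerD => //; apply: ler_wpM2l; first exact: ltW.
by move: b1 b2 gv; rewrite -e1; lra.
Qed.

Lemma BV_relaxed_area u : {within unit_square, continuous u} -> BV S u ->
  (relaxed_area u unit_square < +oo)%E.
Proof.
move=> cu /(BV_inscribed_bound cu)[C /choice[P hP]].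
apply: (@le_lt_trans _ _ C%:E); last by rewrite ltry.
apply: le_trans (_ : limn_einf (fun h => (polyhedral_area (P h).1 (P h).2)%:E) <= _)%E.
  apply: ereal_inf_lbound; exists P => //; split.
  - by move=> h; have [] := hP h.
  - by move=> h; have [] := hP h.
  apply/cvgrPdist_lt => e e0.
  have e2 : 0 < e / 2 by rewrite divr_gt0.
  have [k] := ltr_add_invr e2; rewrite add0r => ke.
  exists k => // h /= kh; have [_ _ /andP[m0 m1] _] := hP h.
  rewrite sub0r normrN ger0_norm//; apply: le_lt_trans m1 _.
  have : h.+1%:R^-1 <= k.+1%:R^-1 :> R by rewrite lef_pV2 ?posrE ?ltr0n// ler_nat ltnS.
  by move: ke; move: (h.+1%:R^-1) (k.+1%:R^-1) => a b ? ?; lra.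
rewrite limn_einf_lim; apply: lime_le; first exact: is_cvg_einfs.
apply: nearW => n; apply: (@le_trans _ _ (polyhedral_area (P n).1 (P n).2)%:E).
  by apply: ereal_inf_lbound; exists n => //=.
by rewrite lee_fin; have [] := hP n.
Qed.

End BVToRelaxed.

Theorem proposition5p1 (R : realType) (u : R * R -> R)
    (hu : {within unit_square, continuous u}) :
  BV unit_square^° u <-> (relaxed_area u unit_square < +oo)%E.
Proof.
by split; [exact: BV_relaxed_area|exact: relaxed_area_BV].
Qed.
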